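(* Fix an integer $k\ge 0$ and a sequence $\bm\delta=(\delta_1,\dots,\delta_k)$ of positive reals, and let $x,y\in[0,1]$ (with $x=y$ when $k=0$). Then \[C_k(n^{x},n,\dots,n,n^{y})=\tilde O\left(n^{\frac{f(k)+x+y}{3}}\right),\] where $f(k)=k+2$ if $k\equiv 2\pmod 3$ and $f(k)=k+1$ otherwise. (Here the first argument is $n^x$, the last is $n^y$, and the $k-1$ middle arguments equal $n$.)
   Context: For a fixed $\bm\delta=(\delta_1,\dots,\delta_k)$ and sets $P_1,\dots,P_{k+1}\subseteq\mathbb{R}^2$, let $C_k(P_1,\dots,P_{k+1})$ be the number of $(k+1)$-tuples $(p_1,\dots,p_{k+1})$ with $p_i\in P_i$ for all $i$, $\|p_i-p_{i+1}\|=\delta_i$ for all $i\in[k]$, and $p_i\ne p_j$ for $i\ne j$. Let $C_k(n_1,\dots,n_{k+1})$ be the maximum of $C_k(P_1,\dots,P_{k+1})$ over all $P_1,\dots,P_{k+1}\subseteq\mathbb{R}^2$ with $|P_i|\le n_i$. $f(n)=\tilde O(g(n))$ means there are positive constants $c,C$ with $f(n)/g(n)\le C\log^c n$ for all sufficiently large $n$. *)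

(* Defs.v *)
From Stdlib Require Import Reals.
From mathcomp Require Import all_boot.
From mathcomp Require Import Rstruct.

Set Implicit Arguments. Unset Strict Implicit. Unset Printing Implicit Defensive.

Definition pt : Type := (R * R)%type.

Definition edist (p q : pt) : R :=
  sqrt (Rplus (Rsqr (Rminus p.1 q.1)) (Rsqr (Rminus p.2 q.2))).

Fixpoint tuples (ls : seq (seq pt)) : seq (seq pt) :=
  match ls with
  | [::] => [:: [::]]
  | l :: ls' => flatten [seq [seq p :: t | t <- tuples ls'] | p <- l]
  end.

Definition p00 : pt := (0%R, 0%R).

(* a (k+1)-tuple t = (p_1,...,p_{k+1}) (0-indexed here) is counted iff the
   points are pairwise distinct and ||p_i - p_{i+1}|| = delta_i for i in [k]. *)
Definition good_tuple (k : nat) (delta : nat -> R) (t : seq pt) : bool :=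
  uniq t && all (fun i => edist (nth p00 t i) (nth p00 t i.+1) == delta i) (iota 0 k).

(* C_k(P_1,...,P_{k+1}) with P i the (duplicate-free list representing the)
   set P_{i+1}, for i = 0..k *)
Definition Ck (k : nat) (delta : nat -> R) (P : nat -> seq pt) : nat :=
  count (good_tuple k delta) (tuples [seq P i | i <- iota 0 k.+1]).

(* size bound for the i-th set (0-indexed): n^x for the first, n^y for the
   last, n for the k-1 middle ones (for k = 0 the single set gets n^x = n^y). *)
Definition size_bound (k : nat) (x y : R) (n : nat) (i : nat) : R :=
  if i == 0 then Rpower (INR n) x
  else if i == k then Rpower (INR n) y
  else INR n.

Definition fk (k : nat) : nat := if k %% 3 == 2 then k + 2 else k + 1.

(* Main.v *)
Require Import Defs.
From Stdlib Require Import Reals Lra Lia Psatz ZArith ClassicalEpsilon.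
From mathcomp Require Import all_boot zify.
From mathcomp Require Import boolp Rstruct.

(**
  All bounds are cubed, so that no fractional exponents occur: with
  [L = ln n], the number of chains satisfies
  [count^3 <= C L^c n^(f k) |P_1| |P_(k+1)|] as soon as every [|P_i| <= n].

  Chains.  Induction on [k] in steps of three.  Split [P_2] dyadically according
  to the number [~ d] of neighbours in [P_1], and let [m] be the size of a class.
  By the incidence bound below, either [d^3 m <= L^6 n |P_1|] up to a constant, or
  there are only [O(|P_1|)] pairs [(p_1, p_2)].  In the second case [p_3] has at
  most two positions once [p_2] and [p_4] are known, and the bound for [k - 3]
  applies to [(p_4, ...)].  In the first case forget [p_1] and use [k - 1]; when
  [k = 0 mod 3] do this at both ends and use [k - 2].

  Incidences.  [m] points and [N] circles of equal radius have
  [I^3 <= C L^6 m^2 N^2], [I = O(m)] or [I = O(N)].  A quarter of a circle extends to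
  the graph of a strictly concave function on the line, two translates of which
  agree at most once, so it suffices to treat such pseudolines.  A greedy hitting
  set of [O(N L / s^2)] curves meets the interior of every trapezoid, bounded by curves
  and vertical lines through vertices, that is crossed by more than [s^2] curves.
  Its vertical decomposition has [O(N^2 L^2 / s^4)] cells, each crossed by at most
  [s^2] curves, and the K_{2,2}-free bound within the cells is summed, with
  [s^3 ~ N^2 / m].
*)

Set Implicit Arguments. Unset Strict Implicit. Unset Printing Implicit Defensive.

(** * Counting in K_{2,2}-free incidence structures *)

Definition incidences (A T : Type) (r : A -> T -> bool) (P : seq A) (Q : seq T) : nat :=
  \sum_(p <- P) count (r p) Q.

Definition K22_free (A T : eqType) (r : A -> T -> bool) (P : seq A) (Q : seq T) : Prop :=
  forall p p' q q', p \in P -> p' \in P -> q \in Q -> q' \in Q ->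
    r p q -> r p q' -> r p' q -> r p' q' -> p = p' \/ q = q'.

Lemma count_sum (T : Type) (a : pred T) (s : seq T) :
  count a s = \sum_(x <- s) (a x : nat).
Proof. by rewrite -sum1_count big_mkcond; apply: eq_bigr => x _; case: (a x). Qed.

Lemma incidences_flip (A T : Type) (r : A -> T -> bool) (P : seq A) (Q : seq T) :
  incidences r P Q = incidences (fun q p => r p q) Q P.
Proof.
rewrite /incidences; under eq_bigr do rewrite count_sum.
by rewrite exchange_big /=; apply: eq_bigr => q _; rewrite count_sum.
Qed.

Lemma K22_free_flip (A T : eqType) (r : A -> T -> bool) (P : seq A) (Q : seq T) :
  K22_free r P Q -> K22_free (fun q p => r p q) Q P.
Proof.
move=> h q q' p p' hq hq' hp hp' h1 h2 h3 h4.
by case: (h p p' q q') => //; [right | left].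
Qed.

Lemma count_le1 (T : eqType) (a : pred T) (s : seq T) :
  uniq s -> (forall x y, x \in s -> y \in s -> a x -> a y -> x = y) ->
  count a s <= 1.
Proof.
move=> us h; rewrite -size_filter.
have := filter_uniq a us; have: forall x y, x \in filter a s -> y \in filter a s -> x = y.
  by move=> x y; rewrite !mem_filter => /andP[ax xs] /andP[ay ys]; apply: h.
case: (filter a s) => [|x [|y l]] //= e.
by rewrite (e x y) ?inE ?eqxx ?orbT.
Qed.

(** Double counting of triples [(p, q, q')] with [p] incident to both: the diagonal gives the
    incidences, and a pair [q <> q'] has at most one common [p]. *)
Lemma sum_sq_degrees (A T : eqType) (r : A -> T -> bool) (P : seq A) (Q : seq T) :
  uniq P -> uniq Q -> K22_free r P Q ->
  \sum_(p <- P) count (r p) Q ^ 2 <= incidences r P Q + size Q ^ 2.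
Proof.
move=> uP uQ free.
have -> : \sum_(p <- P) count (r p) Q ^ 2 =
    \sum_(q <- Q) \sum_(q' <- Q) count (fun p => r p q && r p q') P.
  transitivity (\sum_(p <- P) \sum_(q <- Q) \sum_(q' <- Q) (r p q && r p q' : nat)).
    apply: eq_bigr => p _; rewrite -mulnn count_sum big_distrl /=.
    apply: eq_bigr => q _; rewrite big_distrr /=.
    by apply: eq_bigr => q' _; rewrite mulnb.
  rewrite exchange_big /=; apply: eq_bigr => q _.
  by rewrite exchange_big /=; apply: eq_bigr => q' _; rewrite count_sum.
rewrite incidences_flip /incidences.
have -> : size Q ^ 2 = \sum_(q <- Q) size Q by rewrite big_const_seq count_predT iter_addn_0 -mulnn.
rewrite -big_split /= big_seq [X in _ <= X]big_seq; apply: leq_sum => q qQ.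
rewrite (bigD1_seq q) //=; apply: leq_add.
  by apply: sub_count => p /andP[].
rewrite -sum1_size big_mkcond /= [X in _ <= X]big_seq big_seq.
apply: leq_sum => q' q'Q; case: eqP => //= ne.
apply: count_le1 => // x y xP yP /andP[a1 a2] /andP[b1 b2].
by case: (free x y q q') => // e; case: ne.
Qed.

(** Summing [2 * mu * d <= d ^ 2 + mu ^ 2] over the degrees [d] replaces Cauchy-Schwarz and its
    square root; as [mu >= 1], one copy of [mu * I] absorbs the linear term of [sum_sq_degrees]. *)
Lemma K22_bound (A T : eqType) (r : A -> T -> bool) (P : seq A) (Q : seq T) (mu : nat) :
  uniq P -> uniq Q -> K22_free r P Q -> 0 < mu ->
  mu * incidences r P Q <= size Q ^ 2 + mu ^ 2 * size P.
Proof.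
move=> uP uQ free mu0; have h := sum_sq_degrees uP uQ free.
have h2 : 2 * mu * incidences r P Q <= \sum_(p <- P) count (r p) Q ^ 2 + mu ^ 2 * size P.
  rewrite /incidences big_distrr /=.
  have -> : mu ^ 2 * size P = \sum_(p <- P) mu ^ 2
    by rewrite big_const_seq count_predT iter_addn_0.
  rewrite -big_split /=; apply: leq_sum => p _.
  by rewrite -mulnA addnC; have [] := nat_Cauchy mu (count (r p) Q).
nia.
Qed.

Lemma K22_bound_linear (A T : eqType) (r : A -> T -> bool) (P : seq A) (Q : seq T) :
  uniq P -> uniq Q -> K22_free r P Q ->
  incidences r P Q <= size P + size Q ^ 2.
Proof. by move=> uP uQ /(K22_bound uP uQ) /(_ (ltn0Sn 0)); rewrite !mul1n addnC. Qed.

Lemma K22_bound_flip_linear (A T : eqType) (r : A -> T -> bool) (P : seq A) (Q : seq T) :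
  uniq P -> uniq Q -> K22_free r P Q ->
  incidences r P Q <= size Q + size P ^ 2.
Proof.
move=> uP uQ /K22_free_flip free; rewrite incidences_flip.
exact: K22_bound_linear.
Qed.

(** The flipped bound with [mu] near [|P| / s], which balances its two terms. Being additive in
    [|P|], it can be summed over cells. *)
Lemma K22_bound_sqrt (A T : eqType) (r : A -> T -> bool) (P : seq A) (Q : seq T) (s : nat) :
  uniq P -> uniq Q -> K22_free r P Q -> 0 < s -> size Q <= s ^ 2 ->
  incidences r P Q <= 2 * size P * s + s ^ 2.
Proof.
move=> uP uQ /K22_free_flip free s0 hs.
set mu := (size P %/ s).+1.
have := K22_bound uQ uP free (ltn0Sn _ : 0 < mu).
rewrite -incidences_flip; set I := incidences _ _ _; set a := size P => h.
have h1 : a <= mu * s by rewrite /mu mulSn addnC; have := divn_eq a s; have := ltn_pmod a s0; lia.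
have h2 : mu * s <= a + s by rewrite /mu mulSn; have := leq_trunc_div a s; lia.
have h3 : mu * I <= mu * (a * s + mu * s ^ 2).
  apply: (leq_trans h); rewrite mulnDr; apply: leq_add; first by rewrite -mulnn; nia.
  by rewrite mulnA -mulnn leq_mul2l hs orbT.
rewrite leq_pmul2l // in h3; nia.
Qed.

(** Averaging: if every [q] failed, the pairs counted from the side of [Q] would number fewer than
    [t * size F], the lower bound from the side of [F]. *)
Lemma greedy_pick (I T : eqType) (m : I -> T -> bool) (Q : seq T) (t : nat) (F : seq I) :
  0 < size Q -> (forall a, a \in F -> t <= count (m a) Q) ->
  exists2 q, q \in Q & t * size F <= size Q * count (m^~ q) F.
Proof.
move=> Q0 hF; case: (boolP (has (fun q => t * size F <= size Q * count (m^~ q) F) Q)).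
  by move/hasP=> [q qQ hq]; exists q.
move/hasPn => hn; exfalso.
have h1 : t * size F <= incidences m F Q.
  rewrite /incidences -sum1_size big_distrr /= big_seq [X in _ <= X]big_seq.
  by apply: leq_sum => a aF; rewrite muln1; apply: hF.
have h2 : size Q * incidences m F Q < size Q * (t * size F).
  rewrite incidences_flip /incidences big_distrr /=.
  have -> : size Q * (t * size F) = \sum_(q <- Q) t * size F.
    by rewrite big_const_seq count_predT iter_addn_0 mulnC.
  case: Q Q0 hn {hF h1} => // q0 Q' _ hn; rewrite !big_cons.
  have hq q : q \in q0 :: Q' -> (size (q0 :: Q') * count (m^~ q) F < t * size F).
    by move/hn; rewrite -ltnNge.
  rewrite -addSn; apply: leq_add; first by apply: hq; rewrite inE eqxx.
  rewrite big_seq [X in _ <= X]big_seq; apply: leq_sum => q qQ.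
  by apply: ltnW; apply: hq; rewrite inE qQ orbT.
by move: h2; rewrite ltn_pmul2l // ltnNge h1.
Qed.

(** Each pick leaves at most a fraction [1 - t / |Q|] of the members not yet hit; multiplying by
    [|Q| ^ g] keeps the estimate in the naturals. *)
Lemma greedy_hitting (I T : eqType) (m : I -> T -> bool) (Q : seq T) (t g : nat) (F : seq I) :
  0 < size Q -> (forall a, a \in F -> t <= count (m a) Q) ->
  exists S : seq T, [/\ {subset S <= Q}, size S = g &
    count (fun a => ~~ has (m a) S) F * size Q ^ g <= size F * (size Q - t) ^ g].
Proof.
move=> Q0; elim: g F => [|g IH] F hF.
  by exists [::]; split=> //; rewrite !expn0 !muln1 count_size.
have [q qQ hq] := greedy_pick Q0 hF.
case: (IH (filter (fun a => ~~ m a q) F)) => [a|S [sS szS hS]].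
  by rewrite mem_filter => /andP[_ /hF].
exists (q :: S); split=> /=.
- by move=> x; rewrite inE => /orP[/eqP -> //|/sS].
- by rewrite szS.
have e : count (fun a => ~~ (m a q || has (m a) S)) F =
         count (fun a => ~~ has (m a) S) (filter (fun a => ~~ m a q) F).
  by rewrite count_filter; apply: eq_count => a /=; rewrite negb_or andbC.
rewrite e !expnS.
have h1 : size Q * size (filter (fun a => ~~ m a q) F) <= size F * (size Q - t).
  rewrite size_filter; have := count_predC (m^~ q) F.
  rewrite -[count (predC _) F]/(count (fun a => ~~ m a q) F) => h.
  have -> : count (fun a => ~~ m a q) F = size F - count (m^~ q) F by lia.
  by rewrite !mulnBr [size Q * _]mulnC leq_sub2l // mulnC.
rewrite mulnCA; apply: leq_trans (_ : size Q * (size (filter (fun a => ~~ m a q) F) * (size Q - t) ^ g) <= _).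
  by rewrite leq_mul2l hS orbT.
by rewrite !mulnA leq_mul2r h1 orbT.
Qed.

(** * Vertical decomposition of an arrangement of pseudolines *)

Local Open Scope R_scope.

Lemma ex_argmin (T : eqType) (phi : T -> R) (a : T -> Prop) (s : seq T) :
  (exists2 x, x \in s & a x) ->
  exists x, [/\ x \in s, a x & forall y, y \in s -> a y -> phi x <= phi y].
Proof.
elim: s => [|z s IH] [x]; first by rewrite in_nil.
move=> xs ax; case: (EM (exists2 x, x \in s & a x)) => [/IH [y [ys ay my]]|ns].
- case: (EM (a z /\ phi z <= phi y)) => [[az le]|nle].
    exists z; split=> [|//|w]; first by rewrite inE eqxx.
    rewrite inE => /orP[/eqP ->|ws] aw; first lra.
    by have := my w ws aw; lra.
  exists y; split=> [|//|w]; first by rewrite inE ys orbT.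
  rewrite inE => /orP[/eqP ->|ws] aw; last exact: my.
  by case: (Rle_dec (phi y) (phi z)) => // n; case: nle; split=> //; lra.
- have ez w : w \in z :: s -> a w -> w = z.
    by rewrite inE => /orP[/eqP //|ws aw]; case: ns; exists w.
  by exists x; split=> // y ys ay; rewrite (ez x) // (ez y) //; lra.
Qed.

Section VerticalDecomposition.

Variables (U : eqType) (f : U -> R -> R) (D : seq U) (B : R).
Hypothesis f_cont : forall u, u \in D -> continuity (f u).
Hypothesis f_agree : forall u v x y, u \in D -> v \in D -> u <> v ->
  f u x = f v x -> f u y = f v y -> x = y.

(** Totalised by choice: for curves that never meet, or for [u = v], the value has no geometric
    meaning. Such spurious marks merely add walls. *)
Definition crossing (u v : U) : R := epsilon (inhabits 0) (fun x => f u x = f v x).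

Lemma crossing_eq (u v : U) (x : R) : u \in D -> v \in D -> u <> v ->
  f u x = f v x -> crossing u v = x.
Proof.
move=> uD vD ne e; apply: (f_agree uD vD ne) => //.
by apply: (epsilon_spec (inhabits 0) (fun x => f u x = f v x)); exists x.
Qed.

(** Intermediate values of [f u - f v]. The exclusion [z <> x] matters when a wall passes through
    the starting point. *)
Lemma agree_between (u v : U) (x y : R) : u \in D -> v \in D ->
  f u x < f v x -> f v y <= f u y ->
  exists z, [/\ Rmin x y <= z <= Rmax x y, z <> x & f u z = f v z].
Proof.
move=> uD vD h1 h2.
have c : continuity (fun t => f u t - f v t) by apply: continuity_minus; apply: f_cont.
have [le|le] := Rle_lt_dec x y.
  have [|z [[z1 z2] ez]] := IVT_cor _ x y c le; first by nra.
  exists z; rewrite Rmin_left // Rmax_right //.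
  by split=> [//|ex|]; [subst z; lra | lra].
have [||z [[z1 z2] ez]] := IVT_cor _ y x c; [lra | by nra |].
exists z; rewrite Rmin_right ?Rmax_left; try lra.
by split=> [//|ex|]; [subst z; lra | lra].
Qed.

(** [-B] and [B] are outer walls, so that every abscissa strictly between them has a mark on either
    side. *)
Definition marks (S : seq U) (v : U) : seq R := -B :: B :: [seq crossing v w | w <- S].

(* [(u, d, x1, x2)]: ceiling, floor, left wall, right wall. *)
Definition trapezoid : Type := (U * U * R * R)%type.

Definition crosses (rho : trapezoid) (h : R -> R) : Prop :=
  let '(u, d, x1, x2) := rho in exists x, x1 < x < x2 /\ f d x < h x < f u x.

(** By the last clause the right wall is the first mark after the left one, which is what lets
    [cell_key] determine the cell. *)
Definition is_cell (S : seq U) (rho : trapezoid) : Prop :=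
  let '(u, d, x1, x2) := rho in
  [/\ u \in S, d \in S, x1 \in marks S u ++ marks S d, x2 \in marks S u ++ marks S d & x1 < x2] /\
  (forall x, x1 < x < x2 -> f d x < f u x /\ forall w, w \in S -> f w x <= f d x \/ f u x <= f w x) /\
  (forall z, z \in marks S u ++ marks S d -> z <= x1 \/ x2 <= z).

Lemma cell_not_crossed (S : seq U) (rho : trapezoid) (w : U) :
  is_cell S rho -> w \in S -> ~ crosses rho (f w).
Proof.
case: rho => [[[u d] x1] x2] [_ [h _]] wS [x [/h [_ /(_ _ wS)]]]; lra.
Qed.

Lemma mem_marks (S : seq U) (v w : U) : w \in S -> crossing v w \in marks S v.
Proof. by move=> wS; rewrite !inE map_f ?orbT. Qed.

(* The ceiling and floor are compared slightly to the right of [x0], so that a vertex exactly above or below the point does no harm. *)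
Lemma cell_exists (S : seq U) (top bot : U) (x0 y0 : R) :
  {subset S <= D} -> -B < x0 < B -> top \in S -> bot \in S ->
  f bot x0 < y0 < f top x0 -> (forall w, w \in S -> f w x0 <> y0) ->
  exists rho, is_cell S rho /\
    forall h, continuity h -> h x0 = y0 -> crosses rho h.
Proof.
move=> SD x0B topS botS [hb ht] off.
pose Z := flatten [seq marks S v | v <- S].
have mZ v z : v \in S -> z \in marks S v -> z \in Z.
  by move=> vS zv; apply/flattenP; exists (marks S v) => //; apply: map_f.
(* No mark lies in [(x0, xp]], so the sample curves have at [xp] the vertical order that they have
   just to the right of [x0]. *)
have [xp [xp0 hxp]] : exists xp, x0 < xp /\ forall z, z \in Z -> ~ (x0 < z <= xp).
  have [|z [_ z0 mz]] := @ex_argmin _ id (fun z => x0 < z) (B :: Z).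
    by exists B; rewrite ?inE ?eqxx //; lra.
  exists ((x0 + z) / 2); split; first lra.
  by move=> w wZ [w1 w2]; have := mz w; rewrite inE wZ orbT /= => /(_ isT w1); lra.
have [|u [uS uy mu]] := @ex_argmin _ (fun w => f w xp) (fun w => y0 < f w x0) S.
  by exists top.
have [|d [dS dy md]] := @ex_argmin _ (fun w => - f w xp) (fun w => f w x0 < y0) S.
  by exists bot.
set xs := marks S u ++ marks S d.
have xsZ z : z \in xs -> z \in Z by rewrite mem_cat => /orP[]; apply: mZ.
(* The left wall may be [x0] itself, while the right wall lies beyond it; hence a curve through the
   point is shown below to enter the open cell just to the right of [x0]. *)
have [|x1 [x1s x1x m1]] := @ex_argmin _ Ropp (fun z => z <= x0) xs.
  by exists (-B); rewrite ?inE ?eqxx //; lra.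
have [|x2 [x2s x2x m2]] := @ex_argmin _ id (fun z => x0 < z) xs.
  by exists B; rewrite ?inE ?eqxx ?orbT //; lra.
have gap z : z \in xs -> z <= x1 \/ x2 <= z.
  move=> zs; case: (Rle_lt_dec z x0) => hz; first by have := m1 _ zs hz; lra.
  by have := m2 _ zs hz; rewrite /=; lra.
have xp2 : xp < x2 by have := hxp _ (xsZ _ x2s); lra.
have inS v w : v \in S -> w \in S -> crossing v w \in marks S v by move=> vS; apply: mem_marks.
have du : d <> u by move=> e; subst d; lra.
exists (u, d, x1, x2); split.
  split; first by split=> //; lra.
  split; last exact: gap.
  (* Any failure would, by continuity, produce a crossing on the ceiling or the floor strictly
     between the walls, which [gap] forbids. *)
  move=> x [hx1 hx2]; split.
    case: (Rlt_le_dec (f d x) (f u x)) => // le.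
    have [|z [zb zn ez]] := agree_between (x := x0) (SD _ dS) (SD _ uS) _ le; first lra.
    have ec := crossing_eq (SD _ dS) (SD _ uS) du ez.
    have : z \in xs by rewrite mem_cat -ec inS ?orbT.
    move/gap; move: zb; rewrite /Rmin /Rmax; case: Rle_dec => _; lra.
  move=> w wS; case: (Rle_lt_dec (f w x) (f d x)) => [|wd]; first by left.
  case: (Rle_lt_dec (f u x) (f w x)) => [|wu]; first by right.
  exfalso; have := off _ wS => nw.
  case: (Rle_lt_dec (f w x0) y0) => hw.
    have {}hw : f w x0 < y0 by lra.
    have [|z [zb zn ez]] := agree_between (SD _ dS) (SD _ wS) wd (y := xp).
      by have := md _ wS hw; lra.
    have dw : d <> w by move=> e; subst w; lra.
    have ec := crossing_eq (SD _ dS) (SD _ wS) dw ez.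
    have : z \in xs by rewrite mem_cat -ec inS ?orbT.
    by move/gap; move: zb; rewrite /Rmin /Rmax; case: Rle_dec => _; lra.
  have [|z [zb zn ez]] := agree_between (SD _ wS) (SD _ uS) wu (y := xp).
    by have := mu _ wS hw; lra.
  have uw : u <> w by move=> e; subst w; lra.
  have ec := crossing_eq (SD _ uS) (SD _ wS) uw (esym ez).
  have : z \in xs by rewrite mem_cat -ec inS.
  by move/gap; move: zb; rewrite /Rmin /Rmax; case: Rle_dec => _; lra.
move=> h hc e0.
have near (k : R -> R) : continuity k -> 0 < k x0 ->
    exists e, 0 < e /\ forall x, x0 < x < x0 + e -> 0 < k x.
  move=> kc k0; have [e [e0' he]] := kc x0 (k x0) k0.
  exists e; split=> // x xb.
  have : Rabs (k x - k x0) < k x0.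
    apply: (he x); split; first by split=> //; lra.
    by rewrite /= /Rdist Rabs_right; lra.
  by move/Rabs_def2; lra.
have [||e1 [e1p h1]] := near (fun x => h x - f d x).
- exact: (continuity_minus _ _ hc (f_cont (SD _ dS))).
- by lra.
have [||e2 [e2p h2]] := near (fun x => f u x - h x).
- exact: (continuity_minus _ _ (f_cont (SD _ uS)) hc).
- by lra.
pose e := Rmin (Rmin e1 e2) (x2 - x0).
have [ea eb ec ed] : [/\ 0 < e, e <= e1, e <= e2 & e <= x2 - x0].
  have := Rmin_l (Rmin e1 e2) (x2 - x0); have := Rmin_r (Rmin e1 e2) (x2 - x0).
  have := Rmin_l e1 e2; have := Rmin_r e1 e2; rewrite -/e => *; split; try lra.
  by do 2? apply: Rmin_glb_lt; lra.
exists (x0 + e / 2); split; first lra.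
have := h1 (x0 + e / 2); have := h2 (x0 + e / 2); lra.
Qed.

Definition cell_key (S : seq U) (rho : trapezoid) : bool * U * R :=
  let '(u, d, x1, x2) := rho in
  if x1 \in marks S u then (true, u, x1) else (false, d, x1).

(* A cell is determined by its left wall together with the curve carrying the corresponding vertex: the opposite side and the right wall are then forced. *)
Lemma cell_key_inj (S : seq U) (rho rho' : trapezoid) : {subset S <= D} ->
  is_cell S rho -> is_cell S rho' -> cell_key S rho = cell_key S rho' -> rho = rho'.
Proof.
move=> SD; case: rho => [[[u d] x1] x2]; case: rho' => [[[u' d'] x1'] x2'].
move=> [[uS dS x1s x2s lt] [h g]] [[uS' dS' x1s' x2s' lt'] [h' g']] /= key.
have e1 : x1 = x1' by move: key; do 2 case: ifP => _; case.
subst x1'.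
have same v v' : v \in S -> v' \in S ->
    (forall x, x1 < x < Rmin x2 x2' -> f v x = f v' x) -> v = v'.
  move=> vS vS' ag; case: (v =P v') => // ne; exfalso.
  pose m := Rmin x2 x2'; have m1 : x1 < m by rewrite /m /Rmin; case: Rle_dec; lra.
  have := f_agree (SD _ vS) (SD _ vS') ne (ag (x1 + (m - x1) / 2) _) (ag (x1 + (m - x1) / 3) _).
  by rewrite -/m => H; have := H ltac:(lra) ltac:(lra); lra.
have mm x : x1 < x < Rmin x2 x2' -> x1 < x < x2 /\ x1 < x < x2'.
  by rewrite /Rmin; case: Rle_dec; lra.
have [eu ed] : u = u' /\ d = d'.
  move: key; case: ifP => _; case: ifP => _ //; case=> e; subst; split=> //.
    apply: same => // x /mm [b b'].
    have [a c] := h _ b; have [a' c'] := h' _ b'.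
    by have := c _ dS'; have := c' _ dS; lra.
  apply: same => // x /mm [b b'].
  have [a c] := h _ b; have [a' c'] := h' _ b'.
  by have := c _ uS'; have := c' _ uS; lra.
subst u' d'; congr (_, _, _, _).
by have := g' _ x2s; have := g _ x2s'; lra.
Qed.

(** Quadratically many candidates in [|S|]; by injectivity of the keys they bound the number of
    cells. *)
Definition cell_keys (S : seq U) : seq (bool * U * R) :=
  [seq (bv, z) | bv <- [seq (b, v) | b <- [:: true; false], v <- S], z <- marks S bv.2].

Lemma mem_cell_keys (S : seq U) (rho : trapezoid) :
  is_cell S rho -> cell_key S rho \in cell_keys S.
Proof.
case: rho => [[[u d] x1] x2] [[uS dS x1s _ _] _]; rewrite /cell_key.
have k b v : v \in S -> x1 \in marks S v -> (b, v, x1) \in cell_keys S.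
  move=> vS xv; apply/allpairsPdep; exists (b, v), x1; split=> //.
  by apply: allpairs_f => //; case: b.
case: ifP => [|n]; first exact: k.
by apply: k => //; move: x1s; rewrite mem_cat n.
Qed.

Lemma size_cell_keys (S : seq U) : size (cell_keys S) = (2 * size S * (size S).+2)%N.
Proof.
rewrite size_allpairs_dep sumnE big_map.
under eq_bigr do rewrite /marks /= size_map.
by rewrite big_const_seq count_predT iter_addn_0 size_allpairs mulnC.
Qed.

(** The hitting set is chosen for a family fixed in advance, so this crude finite superset is built
    from all of [D]; only the logarithm of its size will matter. *)
Definition all_trapezoids : seq trapezoid :=
  let Z := flatten [seq marks D v | v <- D] in
  [seq (udx, x2) | udx <- [seq (ud, x1) | ud <- [seq (u, d) | u <- D, d <- D], x1 <- Z], x2 <- Z].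

Lemma mem_all_trapezoids (S : seq U) (rho : trapezoid) : {subset S <= D} ->
  is_cell S rho -> rho \in all_trapezoids.
Proof.
move=> SD; case: rho => [[[u d] x1] x2] [[uS dS x1s x2s _] _].
have Zm z : z \in marks S u ++ marks S d -> z \in flatten [seq marks D v | v <- D].
  have sub v : v \in S -> z \in marks S v -> z \in flatten [seq marks D v | v <- D].
    move=> vS zv; apply/flattenP; exists (marks D v); first by apply: map_f; apply: SD.
    move: zv; rewrite !inE => /or3P[->|->|/mapP[w wS ->]]; rewrite ?orbT //.
    by rewrite (map_f (crossing v)) ?orbT //; apply: SD.
  by rewrite mem_cat => /orP[]; apply: sub.
by do 3! (apply: allpairs_f; last by [apply: Zm | apply: SD]); apply: SD.
Qed.

Lemma size_all_trapezoids : (size all_trapezoids <= (size D).+1 ^ 6)%N.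
Proof.
rewrite /all_trapezoids !size_allpairs.
have -> : size (flatten [seq marks D v | v <- D]) = (size D * (size D).+2)%N.
  rewrite size_flatten sumnE /shape !big_map.
  under eq_bigr do rewrite /marks /= size_map.
  by rewrite big_const_seq count_predT iter_addn_0 mulnC.
set n := size D.
have h : (n * n.+2 <= n.+1 ^ 2)%N by nia.
have -> : (n.+1 ^ 6 = n.+1 ^ 2 * n.+1 ^ 2 * n.+1 ^ 2)%N by rewrite -!expnD.
by apply: leq_mul => //; apply: leq_mul => //; rewrite -mulnn; apply: leq_mul.
Qed.

End VerticalDecomposition.

(** * Incidences between points and pseudolines *)

Local Open Scope R_scope.

(** Supplies continuous majorants, from which the outermost ceiling and floor are made. *)
Lemma ex_dominating (T : eqType) (h : T -> R -> R) (s : seq T) :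
  (forall t, continuity (h t)) ->
  exists M, continuity M /\ forall x, 0 < M x /\ forall t, t \in s -> Rabs (h t x) < M x.
Proof.
move=> hc; elim: s => [|t s [M [Mc hM]]].
  exists (fun _ => 1); split; first by apply: continuity_const.
  by move=> x; split; [lra | move=> t; rewrite in_nil].
exists (fun x => Rabs (h t x) + M x); split.
  exact: (continuity_plus _ _ (continuity_comp _ _ (hc t) Rcontinuity_abs) Mc).
move=> x; have [M0 Ms] := hM x; have := Rabs_pos (h t x); split; first lra.
by move=> t'; rewrite inE => /orP[/eqP ->|/Ms]; lra.
Qed.

Local Open Scope nat_scope.

Lemma sum_fibers (A I : eqType) (rho : A -> I) (P : seq A) (E : A -> nat) :
  \sum_(p <- P) E p = \sum_(i <- undup (map rho P)) \sum_(p <- P | rho p == i) E p.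
Proof.
rewrite (exchange_big_dep predT) //= big_seq [RHS]big_seq; apply: eq_bigr => p pP.
rewrite big_mkcond (bigD1_seq (rho p)) ?undup_uniq ?mem_undup ?map_f //= eqxx.
by rewrite big1 ?addn0 // => i; rewrite eq_sym => /negPf ->.
Qed.

Lemma leq_count_has (A T : Type) (r : A -> T -> bool) (S : seq T) (a : pred A) (P : seq A) :
  count (fun p => a p && has (r p) S) P <= \sum_(w <- S) count (fun p => a p && r p w) P.
Proof.
elim: S => [|w S IH].
  by rewrite big_nil (eq_count (a2 := pred0)) ?count_pred0 // => p; rewrite andbF.
rewrite big_cons; apply: leq_trans (leq_add (leqnn _) IH).
rewrite -count_predUI; apply: leq_trans (leq_addr _ _).
by apply: sub_count => p /= /andP[-> /orP[->|->]]; rewrite ?orbT.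
Qed.

(* Each non-sample curve meets every sample curve at most once. *)
Lemma incidences_on_sample (A T : eqType) (r : A -> T -> bool) (P : seq A) (Q S : seq T) :
  uniq P -> uniq Q -> K22_free r P Q -> {subset S <= Q} ->
  incidences r (filter (fun p => has (r p) S) P) Q <=
    size P + size S ^ 2 + size Q * size S.
Proof.
move=> uP uQ free SQ; set P1 := filter _ P.
have P1P : {subset P1 <= P} by move=> p; rewrite mem_filter => /andP[].
have -> : incidences r P1 Q = incidences r P1 (filter (mem S) Q)
                            + incidences r P1 (filter (predC (mem S)) Q).
  rewrite /incidences -big_split; apply: eq_bigr => p _ /=.
  by rewrite -count_cat; apply/permP; rewrite perm_sym; apply/permEl; apply: perm_filterC.
apply: leq_add.
  have sub : {subset filter (mem S) Q <= Q} by move=> q; rewrite mem_filter => /andP[].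
  apply: leq_trans (K22_bound_linear _ _ _) _; rewrite ?filter_uniq //.
    by move=> p p' q q' /P1P ? /P1P ? /sub ? /sub ?; apply: free.
  apply: leq_add; first by rewrite size_filter count_size.
  rewrite leq_exp2r //; apply: uniq_leq_size; first by rewrite filter_uniq.
  by move=> q; rewrite mem_filter => /andP[].
rewrite incidences_flip /incidences big_filter.
apply: (@leq_trans (\sum_(q <- Q) size S)); last first.
  by rewrite big_const_seq count_predT iter_addn_0 mulnC.
rewrite big_seq_cond [X in _ <= X]big_seq big_mkcondr /=; apply: leq_sum => q qQ.
case: ifP => // qS; rewrite count_filter.
apply: leq_trans (leq_count_has _ _ _ _) _.
rewrite -sum1_size big_seq [X in _ <= X]big_seq; apply: leq_sum => w wS.
apply: count_le1 => // p p' pP p'P /andP[a1 a2] /andP[b1 b2].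
case: (free p p' q w) => //; first exact: SQ.
by move=> e; rewrite e wS in qS.
Qed.

(** Points are grouped by cell [rho p]. A group sees only the at most [s ^ 2] curves crossing its
    cell, so [K22_bound_sqrt] applies; its linear terms add up to [2 * size P * s], its constants to
    at most [K * s ^ 2]. *)
Lemma incidences_fiberwise (A T I : eqType) (r : A -> T -> bool) (m : I -> T -> bool)
    (rho : A -> I) (P : seq A) (Q : seq T) (s K : nat) :
  uniq P -> uniq Q -> K22_free r P Q -> 0 < s ->
  (forall p q, p \in P -> q \in Q -> r p q -> m (rho p) q) ->
  (forall p, p \in P -> count (m (rho p)) Q <= s ^ 2) ->
  size (undup (map rho P)) <= K ->
  incidences r P Q <= 2 * size P * s + K * s ^ 2.
Proof.
move=> uP uQ free s0 rm ms hK.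
apply: (@leq_trans (2 * size P * s + size (undup (map rho P)) * s ^ 2)); last first.
  by rewrite leq_add2l leq_mul2r hK orbT.
rewrite /incidences (sum_fibers rho).
have -> : 2 * size P * s = \sum_(i <- undup (map rho P)) 2 * count (fun p => rho p == i) P * s.
  rewrite -big_distrl -big_distrr /= -sum1_size (sum_fibers rho P (fun _ => 1)).
  by congr (2 * _ * s); apply: eq_bigr => i _; rewrite sum1_count.
have -> : size (undup (map rho P)) * s ^ 2 = \sum_(i <- undup (map rho P)) s ^ 2.
  by rewrite big_const_seq count_predT iter_addn_0 mulnC.
rewrite -big_split /= big_seq [X in _ <= X]big_seq; apply: leq_sum => i.
rewrite mem_undup => /mapP[p0 p0P ->].
rewrite -big_filter; set P0 := filter _ P.
have P0P p : p \in P0 -> p \in P /\ rho p = rho p0.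
  by rewrite mem_filter => /andP[/eqP].
have -> : \sum_(p <- P0) count (r p) Q = incidences r P0 (filter (m (rho p0)) Q).
  rewrite /incidences big_seq [RHS]big_seq; apply: eq_bigr => p /P0P [pP e].
  rewrite count_filter; apply: eq_in_count => q qQ /=.
  by case: (boolP (r p q)) => // rpq; rewrite /= -e rm.
rewrite -size_filter; apply: K22_bound_sqrt; rewrite ?filter_uniq //.
  move=> p p' q q' /P0P[pP _] /P0P[p'P _]; rewrite !mem_filter => /andP[_ ?] /andP[_ ?].
  exact: free.
by rewrite size_filter; apply: ms.
Qed.

Lemma pseudoline_K22_free (A T : eqType) (X Y : A -> R) (f : T -> R -> R)
    (P : seq A) (Q : seq T) :
  (forall p p', X p = X p' -> Y p = Y p' -> p = p') ->
  (forall q q' x y, q <> q' -> f q x = f q' x -> f q y = f q' y -> x = y) ->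
  K22_free (fun p q => f q (X p) == Y p) P Q.
Proof.
move=> inj fa p p' q q' _ _ _ _ /eqP e1 /eqP e2 /eqP e3 /eqP e4.
case: (q =P q') => [|ne]; [by right | left].
have ex : X p = X p' by apply: (fa _ _ _ _ ne); rewrite ?e1 ?e3.
by apply: inj => //; rewrite -e1 -e3 ex.
Qed.

(** The numerical hypothesis makes [g] greedy picks hit every trapezoid crossed by more than [s ^ 2]
    curves; [size Q + 3] is one more than the number of curves including two outer ones. The first
    three terms account for points on the sample, the rest for points in cells. *)
Lemma pseudoline_incidences (A T : eqType) (X Y : A -> R) (f : T -> R -> R)
    (P : seq A) (Q : seq T) (s g : nat) :
  uniq P -> uniq Q ->
  (forall p p', X p = X p' -> Y p = Y p' -> p = p') ->
  (forall q, continuity (f q)) ->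
  (forall q q' x y, q <> q' -> f q x = f q' x -> f q y = f q' y -> x = y) ->
  0 < s -> 0 < size Q ->
  (size Q).+3 ^ 6 * (size Q - (s ^ 2).+1) ^ g < size Q ^ g ->
  incidences (fun p q => f q (X p) == Y p) P Q <=
    size P + g ^ 2 + size Q * g + (2 * size P * s + 2 * g.+2 * g.+4 * s ^ 2).
Proof.
move=> uP uQ inj fc fa s0 Q0 hg; set r := fun p q => f q (X p) == Y p.
have free : K22_free r P Q by apply: pseudoline_K22_free.
have [M1 [M1c hM1]] := @ex_dominating T f Q fc.
have cst (h : A -> R) p : continuity (fun=> h p) by apply: continuity_const.
have [M2 [M2c hM2]] := @ex_dominating A (fun p _ => Y p) P (cst Y).
have [B' [_ hB']] := @ex_dominating A (fun p _ => X p) P (cst X).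
pose B := B' R0; have {hB'} hB p : p \in P -> Rlt (- B) (X p) /\ Rlt (X p) B.
  by move=> pP; have [_ /(_ _ pP) /Rabs_def2] := hB' R0; rewrite -/B; lra.
(* [M1] dominates the curves and [M2] the ordinates, so the two added curves meet neither each other
   nor a curve of [Q], and they enclose all points. *)
pose F (u : (bool + T)%type) : R -> R :=
  match u with
  | inl true => fun x => Rplus (M1 x) (M2 x)
  | inl false => fun x => Ropp (M1 x + M2 x)
  | inr q => f q
  end.
pose ext (s : seq T) : seq (bool + T)%type := inl true :: inl false :: map inr s.
pose D := ext Q.
have F_cont u : u \in D -> continuity (F u).
  move=> _; have cM : continuity (fun x => Rplus (M1 x) (M2 x)) by apply: continuity_plus.
  by case: u => [[]|q] //=; apply: continuity_opp.
have inD q : inr q \in D -> q \in Q.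
  by rewrite !inE /= => /mapP[q' q'Q [->]].
have bQ q x : q \in Q -> Rlt (- M1 x) (f q x) /\ Rlt (f q x) (M1 x).
  by move=> qQ; have [_ /(_ _ qQ) /Rabs_def2] := hM1 x; lra.
have F_agree u v x y : u \in D -> v \in D -> u <> v ->
    F u x = F v x -> F u y = F v y -> x = y.
  have [m1 _] := hM1 x; have [m2 _] := hM2 x.
  case: u => [b|q]; case: v => [b'|q'] /=.
  - by move=> _ _; case: b; case: b' => // _; lra.
  - by move=> _ /inD /(bQ _ x) ? _; case: b; lra.
  - by move=> /inD /(bQ _ x) ? _ _; case: b'; lra.
  - by move=> _ _ ne; apply: fa => e; case: ne; rewrite e.
pose m (rho : trapezoid (bool + T)%type) q := `[< crosses F rho (f q) >].
pose Fam := filter (fun rho => (s ^ 2) < count (m rho) Q) (all_trapezoids F D B).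
have [|S [SQ szS hS]] := @greedy_hitting _ _ m Q (s ^ 2).+1 g Fam Q0.
  by move=> rho; rewrite mem_filter => /andP[].
have {hS} hit rho : rho \in Fam -> has (m rho) S.
  (* If positive, this count times [|Q| ^ g] would be at least [|Q| ^ g], against the hypothesis. *)
  have c0 : count (fun rho => ~~ has (m rho) S) Fam = 0.
    case: (posnP (count (fun rho => ~~ has (m rho) S) Fam)) => // cpos.
    have : size Q ^ g <= (size Q).+3 ^ 6 * (size Q - (s ^ 2).+1) ^ g.
      apply: leq_trans (leq_trans hS _); first by rewrite leq_pmull.
      rewrite leq_mul2r; apply/orP; right.
      rewrite size_filter; apply: leq_trans (count_size _ _) _.
      by apply: leq_trans (size_all_trapezoids _ _ _) _; rewrite /= size_map.
    by rewrite leqNgt hg.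
  move=> rF; apply/negPn/negP => nh.
  have : has (fun rho => ~~ has (m rho) S) Fam by apply/hasP; exists rho.
  by rewrite has_count c0.
have SD : {subset ext S <= D}.
  move=> u; rewrite !inE => /or3P[->|->|/mapP[q qS ->]]; rewrite ?orbT //.
  by rewrite /= map_f ?orbT //; apply: SQ.
set P2 := filter (predC (fun p => has (r p) S)) P.
have -> : incidences r P Q = incidences r (filter (fun p => has (r p) S) P) Q + incidences r P2 Q.
  by rewrite /incidences !big_filter (bigID (fun p => has (r p) S)).
apply: leq_add; first by rewrite -szS; apply: incidences_on_sample.
have P2P p : p \in P2 -> p \in P by rewrite mem_filter => /andP[].
have /boolp.choice [rho hrho] : forall p, exists rho : trapezoid (bool + T)%type, p \in P2 ->
    is_cell F B (ext S) rho /\ forall h, continuity h -> h (X p) = Y p -> crosses F rho h.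
  move=> p.
  (* Points off the sample get a cell; elsewhere the value is a dummy. *)
  case: (boolP (p \in P2)) => [pP2|_]; last by exists (inl true, inl true, R0, R0).
  have [m1 _] := hM1 (X p); have [m2 hy] := hM2 (X p).
  have /Rabs_def2 yb := hy _ (P2P _ pP2).
  have [||||rh hrh] := @cell_exists _ F D B F_cont F_agree (ext S) (inl true) (inl false)
    (X p) (Y p) SD (hB _ (P2P _ pP2)).
  - by rewrite !inE eqxx.
  - by rewrite !inE eqxx orbT.
  - by rewrite /=; lra.
  - move=> w; rewrite !inE => /or3P[/eqP ->|/eqP ->|/mapP[q qS ->]] /=; [lra | lra |].
    move: pP2; rewrite mem_filter /= => /andP[/hasPn /(_ _ qS) /eqP] //.
  by exists rh.
apply: (@leq_trans (2 * size P2 * s + 2 * g.+2 * g.+4 * s ^ 2)); last first.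
  by rewrite leq_add2r leq_mul2r leq_mul2l size_filter count_size !orbT.
apply: (@incidences_fiberwise _ _ _ r m rho); rewrite ?filter_uniq //.
- by move=> p p' q q' /P2P ? /P2P ?; apply: free.
- move=> p q pP2 qQ /eqP e; apply/asboolP; have [_] := hrho _ pP2; exact.
(* A cell crossed by more than [s ^ 2] curves would belong to [Fam] and so be crossed by a sample
   curve, which no cell is. *)
- move=> p /hrho [cell _]; rewrite leqNgt; apply/negP => big.
  have : rho p \in Fam by rewrite mem_filter big; apply: mem_all_trapezoids cell.
  move/hit/hasP => [q qS /asboolP].
  apply: (@cell_not_crossed _ F B (ext S) (rho p) (inr q)) => //.
  by rewrite !inE /= map_f ?orbT.
have hc i : i \in undup (map rho P2) -> is_cell F B (ext S) i.
  by rewrite mem_undup => /mapP[p /hrho [c _] ->].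
rewrite -(size_map (cell_key F B (ext S))).
have -> : 2 * g.+2 * g.+4 = size (cell_keys F B (ext S)).
  by rewrite size_cell_keys /= size_map szS.
apply: uniq_leq_size.
  rewrite map_inj_in_uniq ?undup_uniq // => i j /hc ci /hc cj.
  exact: (cell_key_inj F_agree SD).
by move=> k /mapP[i /hc ci ->]; apply: mem_cell_keys.
Qed.

(** * Real estimates and the choice of the parameters *)

Local Open Scope R_scope.

Lemma INR_addn (a b : nat) : INR (a + b)%N = INR a + INR b.
Proof. by rewrite -plusE plus_INR. Qed.

Lemma INR_muln (a b : nat) : INR (a * b)%N = INR a * INR b.
Proof. by rewrite -multE mult_INR. Qed.

Lemma INR_expn (a b : nat) : INR (a ^ b)%N = INR a ^ b.
Proof. by elim: b => [|b IH] //=; rewrite expnS INR_muln IH. Qed.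

Lemma INR_leq (a b : nat) : (a <= b)%N -> INR a <= INR b.
Proof. by move/leP/le_INR. Qed.

Lemma leq_INR (a b : nat) : INR a <= INR b -> (a <= b)%N.
Proof. by move/INR_le/leP. Qed.

Lemma ltn_INR (a b : nat) : INR a < INR b -> (a < b)%N.
Proof. by move/INR_lt/ltP. Qed.

Lemma ex_nat_ceil (x : R) : 0 <= x -> exists g : nat, x < INR g <= x + 1.
Proof.
move=> x0; have [h1 h2] := archimed x; exists (Z.to_nat (up x)).
rewrite INR_IZR_INZ Z2Nat.id; first lra.
by apply: le_IZR; lra.
Qed.

Lemma ln_le_mono (x y : R) : 0 < x -> x <= y -> ln x <= ln y.
Proof.
move=> x0 [lt|->]; last exact: Rle_refl.
exact: Rlt_le (ln_increasing _ _ x0 lt).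
Qed.

Lemma ln_ge1 (n : nat) : (3 <= n)%N -> 1 <= ln (INR n).
Proof.
move/INR_leq => h.
rewrite -(ln_exp 1); apply: ln_le_mono; first exact: exp_pos.
have := exp_le_3; move: h; rewrite /=; lra.
Qed.

Lemma exp_pow (x : R) (g : nat) : exp x ^ g = exp (INR g * x).
Proof.
elim: g => [|g IH]; first by rewrite /= Rmult_0_l exp_0.
by rewrite -tech_pow_Rmult IH -exp_plus S_INR; congr exp; ring.
Qed.

(** From [(1 - t / N) ^ g <= exp (- t * g / N) < 1 / F]. If [N <= t], the truncated difference is 0
    and [0 < g] makes its power vanish. *)
Lemma sample_size (N t g : nat) (F : nat) :
  (0 < N)%N -> (0 < F)%N -> (0 < g)%N ->
  INR N * ln (INR F) < INR t * INR g ->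
  (F * (N - t) ^ g < N ^ g)%N.
Proof.
move=> N0 F0 g0 h; case: (leqP N t) => [le|lt].
  have -> : (N - t = 0)%N by lia.
  by rewrite exp0n // muln0 expn_gt0 N0.
have Np : 0 < INR N by apply: lt_0_INR; apply/ltP.
have Fp : 0 < INR F by apply: lt_0_INR; apply/ltP.
apply: ltn_INR; rewrite INR_muln !INR_expn minus_INR; last by apply/leP; lia.
set x := INR t / INR N.
have -> : INR N - INR t = INR N * (1 - x) by rewrite /x; field; lra.
rewrite Rpow_mult_distr.
have tN : INR t < INR N by apply: lt_INR; apply/ltP.
have x1 : 0 <= 1 - x.
  have : x <= 1; last lra.
  by rewrite /x; apply: (Rmult_le_reg_r (INR N)) => //; field_simplify; lra.
have h1 : (1 - x) ^ g <= exp (- x) ^ g.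
  by apply: pow_incr; split=> //; have := exp_ineq1_le (- x); lra.
have h2 : INR F * exp (- x) ^ g < 1.
  rewrite exp_pow -{1}(exp_ln (INR F)) // -exp_plus -exp_0; apply: exp_increasing.
  rewrite /x; apply: (Rmult_lt_reg_r (INR N)) => //.
  have -> : (ln (INR F) + INR g * - (INR t / INR N)) * INR N = INR N * ln (INR F) - INR t * INR g.
    by field; lra.
  lra.
have h3 : 0 < INR N ^ g by apply: pow_lt.
have h4 : INR F * (1 - x) ^ g < 1 by nra.
nra.
Qed.

(** If one of [|P|], [|Q|] is at least the square of the other, the K_{2,2} bounds are already
    linear. Otherwise [s] is the largest integer with [s ^ 3 * |P| <= |Q| ^ 2], which balances the
    cell term against [|P| * s] up to logarithms. *)
Lemma pseudoline_incidences_log (A T : eqType) (X Y : A -> R) (f : T -> R -> R)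
    (P : seq A) (Q : seq T) (n : nat) :
  uniq P -> uniq Q ->
  (forall p p', X p = X p' -> Y p = Y p' -> p = p') ->
  (forall q, continuity (f q)) ->
  (forall q q' x y, q <> q' -> f q x = f q' x -> f q y = f q' y -> x = y) ->
  (3 <= n)%N -> (size Q <= n)%N ->
  let I := INR (incidences (fun p q => f q (X p) == Y p) P Q) in
  let m := INR (size P) in let N := INR (size Q) in let L := ln (INR n) in
  I ^ 3 <= 6000 ^ 3 * L ^ 6 * m ^ 2 * N ^ 2 \/ I <= 2 * m \/ I <= 2 * N.
Proof.
move=> uP uQ inj fc fa n3 Qn /=.
set r := fun p q => f q (X p) == Y p.
have free : K22_free r P Q by apply: pseudoline_K22_free.
have hP := K22_bound_linear uP uQ free; have hQ := K22_bound_flip_linear uP uQ free.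
case: (leqP (size P ^ 2) (size Q)) => c1.
  right; right; have -> : 2 * INR (size Q) = INR (2 * size Q) by rewrite INR_muln.
  by apply: INR_leq; lia.
case: (leqP (size Q ^ 2) (size P)) => c2.
  right; left; have -> : 2 * INR (size P) = INR (2 * size P) by rewrite INR_muln.
  by apply: INR_leq; lia.
left.
have P0 : (0 < size P)%N by case: (size P) c1 => //; rewrite exp0n.
have Q0 : (0 < size Q)%N by case: (size Q) c2 => //; rewrite exp0n.
have ex : exists s, (s ^ 3 * size P <= size Q ^ 2)%N by exists 1%N; rewrite exp1n mul1n ltnW.
have bd s : (s ^ 3 * size P <= size Q ^ 2)%N -> (s <= size Q ^ 2)%N.
  move=> h; apply: leq_trans h; apply: leq_trans (leq_pmulr _ P0).
  by case: s => // s; apply: (@leq_pexp2l s.+1 1 3).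
case: (ex_maxnP ex bd) => s hs maxs.
have s0 : (0 < s)%N by apply: maxs; rewrite exp1n mul1n ltnW.
have hs1 : (size Q ^ 2 < s.+1 ^ 3 * size P)%N.
  by rewrite ltnNge; apply/negP => /maxs; rewrite ltnn.
have mp : 1 <= INR (size P) by apply: (INR_leq P0).
have Np : 1 <= INR (size Q) by apply: (INR_leq Q0).
have sp : 1 <= INR s by apply: (INR_leq s0).
have L1 := ln_ge1 n3.
set m := INR (size P) in mp *; set N := INR (size Q) in Np *; set L := ln (INR n) in L1 *.
set sg := INR s in sp *.
have r1 : sg ^ 3 * m <= N ^ 2.
  by move/INR_leq: hs; rewrite INR_muln !INR_expn.
have r2 : N ^ 2 <= 8 * sg ^ 3 * m.
  move/ltnW/INR_leq: hs1; rewrite INR_muln !INR_expn S_INR -/m -/N -/sg => h.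
  have h' : (sg + 1) ^ 3 <= 8 * sg ^ 3.
    have -> : 8 * sg ^ 3 = (2 * sg) ^ 3 by ring.
    by apply: pow_incr; lra.
  nra.
have r3 : N <= m ^ 2 by move/ltnW/INR_leq: c1; rewrite !INR_expn.
(* Follows from [sg ^ 3 * m <= N ^ 2] and [N <= m ^ 2]. It ensures [G >= 1], so that rounding [g]
   costs only a constant factor. *)
have r4 : sg ^ 2 <= N.
  case: (Rle_lt_dec (sg ^ 2) N) => // lt; exfalso.
  have a1 : N ^ 3 < (sg ^ 2) ^ 3.
    have : 0 < (sg ^ 2 - N) * ((sg ^ 2) ^ 2 + sg ^ 2 * N + N ^ 2).
      by apply: Rmult_lt_0_compat; [lra | nra].
    have <- : (sg ^ 2) ^ 3 - N ^ 3 = (sg ^ 2 - N) * ((sg ^ 2) ^ 2 + sg ^ 2 * N + N ^ 2) by ring.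
    lra.
  have a2 : (sg ^ 3 * m) ^ 2 <= (N ^ 2) ^ 2 by apply: pow_incr; split=> //; nra.
  have a3 : (sg ^ 3 * m) ^ 2 = (sg ^ 2) ^ 3 * m ^ 2 by ring.
  have a4 : N ^ 3 * m ^ 2 < (N ^ 2) ^ 2.
    rewrite a3 in a2; apply: Rlt_le_trans a2.
    by apply: Rmult_lt_compat_r => //; nra.
  have a5 : 0 < N ^ 3 by nra.
  have : N ^ 3 * N <= N ^ 3 * m ^ 2 by apply: Rmult_le_compat_l; lra.
  have -> : N ^ 3 * N = (N ^ 2) ^ 2 by ring.
  lra.
have s2p : 0 < sg ^ 2 by nra.
pose G := N * L / sg ^ 2.
have G1 : 1 <= G.
  by rewrite /G; apply: (Rmult_le_reg_r (sg ^ 2)) => //; field_simplify; nra.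
(* The factor 12 is the exponent 6 times 2, the latter from [size Q + 3 <= n ^ 2]. *)
have [|g [g1 g2]] := @ex_nat_ceil (12 * G); first lra.
have lnF : ln (INR ((size Q).+3 ^ 6)) <= 12 * L.
  rewrite INR_expn ln_pow; last by apply: lt_0_INR; apply/ltP.
  have : ln (INR (size Q).+3) <= 2 * L.
    have -> : 2 * L = ln (INR n ^ 2).
      by rewrite ln_pow ?/L //; apply: lt_0_INR; apply/ltP; apply: leq_trans n3.
    apply: ln_le_mono; first by apply: lt_0_INR; apply/ltP.
    by rewrite -INR_expn; apply: INR_leq; nia.
  rewrite /=; lra.
have gp : (0 < g)%N by apply: ltn_INR; rewrite /=; lra.
have hg : ((size Q).+3 ^ 6 * (size Q - (s ^ 2).+1) ^ g < size Q ^ g)%N.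
  apply: sample_size => //.
  rewrite S_INR (INR_expn s) -/sg -/N.
  have : N * ln (INR ((size Q).+3 ^ 6)) <= N * (12 * L) by apply: Rmult_le_compat_l; lra.
  have -> : N * (12 * L) = sg ^ 2 * (12 * G) by rewrite /G; field; lra.
  have : sg ^ 2 * (12 * G) < sg ^ 2 * INR g by apply: Rmult_lt_compat_l.
  by rewrite Rmult_plus_distr_r; lra.
have := pseudoline_incidences uP uQ inj fc fa s0 Q0 hg.
move/INR_leq; rewrite !(INR_addn, INR_muln, INR_expn) -/r -/m -/N -/sg.
rewrite [INR g.+2]S_INR [INR g.+1]S_INR [INR g.+4]S_INR [INR g.+3]S_INR [INR g.+2]S_INR [INR g.+1]S_INR.
set I := INR (incidences r P Q); set gg := INR g in g1 g2 *.
have -> : INR 2 = 2 by [].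
move=> hI.
have eG : G * sg ^ 2 = N * L by rewrite /G; field; lra.
(* [W] is the common scale: the sample and cell terms are all [O(L ^ 2 * W)], and [W <= 8 * sg * m]
   by maximality of [s]. The 13, 15 and 17 below come from [gg <= 12 * G + 1] and [G >= 1]. *)
pose W := N ^ 2 / sg ^ 2.
have eW : W * sg ^ 2 = N ^ 2 by rewrite /W; field; lra.
have W8 : W <= 8 * sg * m.
  by apply: (Rmult_le_reg_r (sg ^ 2)) => //; rewrite eW; lra.
have W0 : 0 < W by rewrite /W; apply: Rdiv_lt_0_compat => //; nra.
have G2 : G ^ 2 * sg ^ 2 = L ^ 2 * W by rewrite /G /W; field; lra.
have NG : N * G = L * W by rewrite /G /W; field; lra.
have b1 : gg ^ 2 <= 169 * (L ^ 2 * W).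
  rewrite -G2; have : gg ^ 2 <= (13 * G) ^ 2 by apply: pow_incr; lra.
  have : G ^ 2 * 1 <= G ^ 2 * sg ^ 2 by apply: Rmult_le_compat_l; nra.
  nra.
have b2 : N * gg <= 13 * (L ^ 2 * W).
  have : N * gg <= N * (13 * G) by apply: Rmult_le_compat_l; lra.
  have : L * W <= L ^ 2 * W by apply: Rmult_le_compat_r; nra.
  nra.
have b3 : 2 * (gg + 1 + 1) * (gg + 1 + 1 + 1 + 1) * sg ^ 2 <= 510 * (L ^ 2 * W).
  have : (gg + 1 + 1) * (gg + 1 + 1 + 1 + 1) <= (15 * G) * (17 * G).
    by apply: Rmult_le_compat; lra.
  move=> h; have := Rmult_le_compat_r (sg ^ 2) _ _ (Rlt_le _ _ s2p) h.
  rewrite -G2; nra.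
have L2 : 1 <= L ^ 2 by nra.
have b4 : L ^ 2 * W <= L ^ 2 * (8 * sg * m) by apply: Rmult_le_compat_l; lra.
have ms : m <= m * sg by nra.
have b5 : m * sg <= L ^ 2 * (m * sg) by nra.
have fin : I <= 6000 * (L ^ 2 * (m * sg)) by nra.
have I0 : 0 <= I by apply: pos_INR.
apply: Rle_trans (pow_incr _ _ 3 (conj I0 fin)) _.
have -> : (6000 * (L ^ 2 * (m * sg))) ^ 3 = 6000 ^ 3 * L ^ 6 * m ^ 2 * (sg ^ 3 * m) by ring.
apply: Rmult_le_compat_l => //; apply: Rmult_le_pos; last by nra.
by apply: Rmult_le_pos; [lra | apply: pow_le; lra].
Qed.

(** * Incidences between points and circles *)

(** Strict concavity expressed by supporting lines, without derivatives. *)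
Definition strictly_supported (g slope : R -> R) : Prop :=
  forall t0 t, t <> t0 -> g t < g t0 + slope t0 * (t - t0).

(** The supporting lines at the inner points bound the outer values, and their slopes do not
    increase from [t2] to [t3]. *)
Lemma supported_exchange (g slope : R -> R) (t1 t2 t3 t4 : R) :
  strictly_supported g slope -> t1 < t2 -> t2 <= t3 -> t4 - t3 = t2 - t1 ->
  g t1 + g t4 < g t2 + g t3.
Proof.
move=> sup h12 h23 e.
have a1 : g t1 < g t2 + slope t2 * (t1 - t2) by apply: sup; lra.
have a2 : g t4 < g t3 + slope t3 * (t4 - t3) by apply: sup; lra.
rewrite e in a2.
have le : slope t3 <= slope t2.
  case: h23 => [lt|->]; last lra.
  have b1 : g t3 < g t2 + slope t2 * (t3 - t2) by apply: sup; lra.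
  have b2 : g t2 < g t3 + slope t3 * (t2 - t3) by apply: sup; lra.
  have : 0 < (slope t2 - slope t3) * (t3 - t2) by lra.
  nra.
nra.
Qed.

(** Two agreements give [g] equal sums over an outer and an inner pair of arguments with equal gaps,
    against [supported_exchange]. For [c < c'] and [u < v] the outer pair is [u - c'], [v - c]; only
    the order of the inner two is in doubt. *)
Lemma translates_agree_once (g slope : R -> R) (a b a' b' x y : R) :
  strictly_supported g slope -> (a <> a' \/ b <> b') ->
  b + g (x - a) = b' + g (x - a') -> b + g (y - a) = b' + g (y - a') -> x = y.
Proof.
move=> sup.
have core c d c' d' u v : c < c' -> u < v ->
    d + g (u - c) = d' + g (u - c') -> d + g (v - c) = d' + g (v - c') -> False.
  move=> lc lu e1 e2.
  have [le|lt] := Rle_lt_dec (u - c) (v - c').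
    have := @supported_exchange g slope (u - c') (u - c) (v - c') (v - c) sup; lra.
  have := @supported_exchange g slope (u - c') (v - c') (u - c) (v - c) sup; lra.
move=> ne e1 e2; have [lx|[//|lx]] := Rtotal_order x y; exfalso.
- have [la|[ea|la]] := Rtotal_order a a'.
  + exact: core la lx e1 e2.
  + by subst a'; case: ne => //; lra.
  + exact: core la lx (esym e1) (esym e2).
- have [la|[ea|la]] := Rtotal_order a a'.
  + exact: core la lx e2 e1.
  + by subst a'; case: ne => //; lra.
  + exact: core la lx (esym e2) (esym e1).
Qed.

(* The projection of [t] to [-c, c]. *)
Definition clamp (c t : R) : R := (Rabs (t + c) - Rabs (t - c)) / 2.

(* The quarter [|t| <= c] of the circle of radius [c * sqrt 2], continued by parabolas with matching slopes. *)
Definition arc (c t : R) : R :=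
  sqrt (2 * c ^ 2 - clamp c t ^ 2) - Rabs (t - clamp c t) - (t - clamp c t) ^ 2.

Lemma clampP (c t : R) : 0 < c ->
  [\/ t < - c /\ clamp c t = - c, - c <= t <= c /\ clamp c t = t | c < t /\ clamp c t = c].
Proof.
move=> c0; rewrite /clamp.
have [h|h] := Rlt_le_dec t (- c).
  by constructor 1; split=> //; rewrite !Rabs_left; lra.
have [h'|h'] := Rlt_le_dec c t.
  by constructor 3; split=> //; rewrite !Rabs_right; lra.
by constructor 2; split=> //; rewrite Rabs_right ?Rabs_left1; lra.
Qed.

Lemma clamp_range (c t : R) : 0 < c -> - c <= clamp c t <= c.
Proof. by move=> c0; case: (clampP t c0) => -[h ->]; lra. Qed.

Lemma clamp_sq (c t : R) : 0 < c -> clamp c t ^ 2 <= c ^ 2.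
Proof. by move=> c0; case: (clampP t c0) => -[h ->]; nra. Qed.

Lemma arc_continuous (c : R) : 0 < c -> continuity (arc c).
Proof.
move=> c0.
have cabs (h : R -> R) : continuity h -> continuity (fun t => Rabs (h t)).
  by move=> hc; apply: (continuity_comp h Rabs) => //; apply: Rcontinuity_abs.
have cid : continuity id by apply: derivable_continuous; apply: derivable_id.
have ccst (k : R) : continuity (fun _ => k) by apply: continuity_const.
have cc : continuity (clamp c).
  apply: (continuity_mult (fun t => Rabs (t + c) - Rabs (t - c)) (fun _ => / 2)) => //.
  apply: (continuity_minus (fun t => Rabs (t + c)) (fun t => Rabs (t - c))); apply: cabs.
    exact: (continuity_plus id (fun _ => c)).
  exact: (continuity_minus id (fun _ => c)).
have cs : continuity (fun t => t - clamp c t) by apply: (continuity_minus id (clamp c)).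
have csq (h : R -> R) : continuity h -> continuity (fun t => h t ^ 2).
  move=> hc; apply: (continuity_mult h (fun t => h t * 1)) => //.
  exact: (continuity_mult h (fun _ => 1)).
apply: (continuity_minus (fun t => sqrt (2 * c ^ 2 - clamp c t ^ 2) - Rabs (t - clamp c t))
                         (fun t => (t - clamp c t) ^ 2)); last exact: csq.
apply: (continuity_minus (fun t => sqrt (2 * c ^ 2 - clamp c t ^ 2)) (fun t => Rabs (t - clamp c t)));
  last exact: cabs.
move=> t; apply: (continuity_pt_comp (fun t => 2 * c ^ 2 - clamp c t ^ 2) sqrt).
  by apply: (continuity_minus (fun _ => 2 * c ^ 2) (fun t => clamp c t ^ 2)) => //; apply: csq.
by apply: continuity_pt_sqrt; have := clamp_sq t c0; nra.
Qed.

(** The derivative of [arc]: the circle has slopes 1 and -1 at the ends of the quarter, so one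
    formula also covers the parabolas. *)
Definition arc_slope (c t : R) : R :=
  - clamp c t / sqrt (2 * c ^ 2 - clamp c t ^ 2) - 2 * (t - clamp c t).

Lemma arc_supported (c : R) : 0 < c -> strictly_supported (arc c) (arc_slope c).
Proof.
move=> c0 t0 t ne; rewrite /arc /arc_slope.
have q0 := clamp_sq t0 c0; have q := clamp_sq t c0.
have P0 := clampP t0 c0; have r0 := clamp_range t0 c0; have r := clamp_range t c0.
set u0 := clamp c t0 in q0 P0 r0 *; set u := clamp c t in q r *.
set h0 := sqrt (2 * c ^ 2 - u0 ^ 2); set h := sqrt (2 * c ^ 2 - u ^ 2).
have e0 : h0 * h0 = 2 * c ^ 2 - u0 ^ 2 by apply: sqrt_sqrt; nra.
have e : h * h = 2 * c ^ 2 - u ^ 2 by apply: sqrt_sqrt; nra.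
have h0p : 0 < h0 by apply: sqrt_lt_R0; nra.
have hp : 0 < h by apply: sqrt_lt_R0; nra.
have h0c : c <= h0 by case: (Rle_lt_dec c h0) => // lt; nra.
pose k := - u0 / h0.
have ek : k * h0 = - u0 by rewrite /k; field; lra.
have kb : -1 <= k <= 1 by split; nra.
(* Cauchy-Schwarz for the two vectors (u, h) and (u0, h0) of the same length. *)
have A : (u - u0) ^ 2 <= 2 * h0 * (h0 + k * (u - u0) - h).
  have -> : 2 * h0 * (h0 + k * (u - u0) - h) = 2 * (h0 * h0) + 2 * (k * h0) * (u - u0) - 2 * h0 * h by ring.
  rewrite ek; have := pow2_ge_0 (h - h0).
  nra.
(* The absolute value lies above the line of slope [-k] since [|k| <= 1], with equality at [t0],
   because [k] is 1 or -1 whenever [t0] lies outside [[-c, c]]. *)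
have B : 0 <= Rabs (t - u) + k * (t - u).
  by rewrite /Rabs; case: Rcase_abs => ?; nra.
have C : Rabs (t0 - u0) + k * (t0 - u0) = 0.
  case: P0 => -[i0 j0].
  - have eh : h0 = c by apply: Rsqr_inj; rewrite /Rsqr ?e0 ?j0; nra.
    have -> : k = 1 by rewrite /k j0 eh; field; lra.
    by rewrite Rabs_left; lra.
  - by rewrite j0 Rminus_diag Rabs_R0; lra.
  - have eh : h0 = c by apply: Rsqr_inj; rewrite /Rsqr ?e0 ?j0; nra.
    have -> : k = -1 by rewrite /k j0 eh; field; lra.
    by rewrite Rabs_right; lra.
(* If [t0] lies beyond one end of the interval, [u] is on the inner side of that end. *)
have D : 0 <= - (t0 - u0) * (u - u0).
  by case: P0 => -[i0 ->]; nra.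
rewrite -/k.
set w := h0 + k * (u - u0) - h in A.
have sq := pow2_ge_0 (u - u0); have sq' := pow2_ge_0 ((t - u) - (t0 - u0)).
have w0 : 0 <= w by apply: Rnot_lt_le => lt; nra.
suff : 0 < w + ((t - u) - (t0 - u0)) ^ 2 by rewrite /w; nra.
(* Strictness comes from the Cauchy-Schwarz term if [u <> u0], and from the square if [u = u0]. *)
case: (Req_dec u u0) => [eu|neu].
  have : 0 < ((t - u) - (t0 - u0)) ^ 2 by rewrite eu; rewrite -Rsqr_pow2; apply: Rsqr_pos_lt; lra.
  lra.
have : 0 < (u - u0) ^ 2 by rewrite -Rsqr_pow2; apply: Rsqr_pos_lt; lra.
move=> s2; have : 0 < w by apply: Rnot_le_lt => le; nra.
lra.
Qed.

Lemma arc_circle (c x y : R) : 0 < c -> x ^ 2 + y ^ 2 = 2 * c ^ 2 -> Rabs x <= y -> arc c x = y.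
Proof.
move=> c0 e xy; have ax := Rabs_pos x.
have x2 : x ^ 2 <= y ^ 2 by rewrite -(pow2_abs x); apply: pow_incr.
have ex : clamp c x = x.
  by case: (clampP x c0) => -[h //] _; nra.
rewrite /arc ex Rminus_diag Rabs_R0.
have -> : 2 * c ^ 2 - x ^ 2 = y ^ 2 by lra.
by rewrite sqrt_pow2; lra.
Qed.

Lemma pow2_edist (p q : pt) : edist p q ^ 2 = (p.1 - q.1) ^ 2 + (p.2 - q.2) ^ 2.
Proof.
rewrite /edist pow2_sqrt; first by rewrite /Rsqr; ring.
by apply: Rplus_le_le_0_compat; apply: Rle_0_sqr.
Qed.

Lemma arc_incidences (X Y : pt -> R) (c : R) (P Q : seq pt) (n : nat) :
  uniq P -> uniq Q -> (forall p p', X p = X p' -> Y p = Y p' -> p = p') -> 0 < c ->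
  (3 <= n)%N -> (size Q <= n)%N ->
  let I := INR (incidences (fun p q => Y q + arc c (X p - X q) == Y p) P Q) in
  let m := INR (size P) in let N := INR (size Q) in let L := ln (INR n) in
  I ^ 3 <= 6000 ^ 3 * L ^ 6 * m ^ 2 * N ^ 2 \/ I <= 2 * m \/ I <= 2 * N.
Proof.
move=> uP uQ inj c0 n3 Qn.
apply: (pseudoline_incidences_log (f := fun q x => Y q + arc c (x - X q))) => //.
  move=> q; apply: (continuity_plus (fun _ => Y q) (fun x => arc c (x - X q))).
    exact: continuity_const.
  apply: (continuity_comp (fun x => x - X q) (arc c)); last exact: arc_continuous.
  apply: (continuity_minus id (fun _ => X q)); last exact: continuity_const.
  by apply: derivable_continuous; apply: derivable_id.
move=> q q' x y ne; apply: (translates_agree_once (arc_supported c0)).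
case: (Req_dec (X q) (X q')) => [eX|]; [right | by left].
by move=> eY; apply: ne; apply: inj.
Qed.

(** A circle splits into four quarters, each an [arc] after exchanging or reflecting coordinates.
    One quarter carries a fourth of the incidences, whence [24000 = 4 * 6000] and [8 = 4 * 2]. *)
Lemma circle_incidences (delta : R) (P Q : seq pt) (n : nat) :
  0 < delta -> uniq P -> uniq Q -> (3 <= n)%N -> (size Q <= n)%N ->
  let I := INR (incidences (fun p q => edist p q == delta) P Q) in
  let m := INR (size P) in let N := INR (size Q) in let L := ln (INR n) in
  I ^ 3 <= 24000 ^ 3 * L ^ 6 * m ^ 2 * N ^ 2 \/ I <= 8 * m \/ I <= 8 * N.
Proof.
move=> d0 uP uQ n3 Qn I m N L.
pose c := delta / sqrt 2.
have s2 : 0 < sqrt 2 by apply: sqrt_lt_R0; lra.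
have c0 : 0 < c by apply: Rdiv_lt_0_compat.
have ec : 2 * c ^ 2 = delta ^ 2.
  have e2 : sqrt 2 * sqrt 2 = 2 by apply: sqrt_sqrt; lra.
  by rewrite /c -{1}e2; field; lra.
pose r (X Y : pt -> R) (p q : pt) := Y q + arc c (X p - X q) == Y p.
pose fst' (p : pt) := p.1; pose snd' (p : pt) := p.2.
pose nfst (p : pt) := - p.1; pose nsnd (p : pt) := - p.2.
have key X Y : (forall p p' : pt, X p = X p' -> Y p = Y p' -> p = p') ->
    I <= 4 * INR (incidences (r X Y) P Q) ->
    I ^ 3 <= 24000 ^ 3 * L ^ 6 * m ^ 2 * N ^ 2 \/ I <= 8 * m \/ I <= 8 * N.
  move=> inj hI.
  have := arc_incidences uP uQ inj c0 n3 Qn; rewrite -/(r X Y) /=.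
  rewrite -/m -/N -/L; set J := INR _ in hI *.
  case=> [h|[h|h]]; [left | right; left; lra | right; right; lra].
  have : I ^ 3 <= (4 * J) ^ 3 by apply: pow_incr; split=> //; apply: pos_INR.
  have -> : (4 * J) ^ 3 = 64 * J ^ 3 by ring.
  have -> : 24000 ^ 3 * L ^ 6 * m ^ 2 * N ^ 2 = 64 * (6000 ^ 3 * L ^ 6 * m ^ 2 * N ^ 2) by ring.
  by move: h; rewrite /=; lra.
have split : (incidences (fun p q => edist p q == delta) P Q <=
    incidences (r fst' snd') P Q + incidences (r fst' nsnd) P Q +
    incidences (r snd' fst') P Q + incidences (r snd' nfst) P Q)%N.
  rewrite /incidences -!big_split /=; apply: leq_sum => p _.
  rewrite !count_sum -!big_split /=; apply: leq_sum => q _.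
  case: eqP => // e; have := pow2_edist p q; rewrite e -ec => e'.
  set dx := p.1 - q.1 in e'; set dy := p.2 - q.2 in e'.
  have ok X Y : (X p - X q) ^ 2 + (Y p - Y q) ^ 2 = 2 * c ^ 2 ->
      Rabs (X p - X q) <= Y p - Y q -> r X Y p q.
    by move=> h1 h2; apply/eqP; rewrite (arc_circle c0 h1 h2); lra.
  have [h|h] := Rle_lt_dec (Rabs dx) (Rabs dy).
    have [h'|h'] := Rle_lt_dec 0 dy.
      by rewrite (ok fst' snd') // /fst' /snd'; rewrite ?(Rabs_right dy) -/dx -/dy in h *; lra.
    rewrite (ok fst' nsnd) ?addnS // /fst' /nsnd -/dx.
      by rewrite e' /dx /dy; ring.
    by rewrite (Rabs_left dy) // in h; rewrite /dy in h; lra.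
  have [h'|h'] := Rle_lt_dec 0 dx.
    rewrite (ok snd' fst') ?addnS // /fst' /snd' -/dx -/dy; first by lra.
    by rewrite (Rabs_right dx) in h; lra.
  rewrite (ok snd' nfst) ?addnS // /nfst /snd' -/dy.
    by rewrite e' /dx /dy; ring.
  by rewrite (Rabs_left dx) // in h; rewrite /dx in h; lra.
move/INR_leq: split; rewrite !INR_addn -/I.
set i1 := INR _; set i2 := INR _; set i3 := INR _; set i4 := INR _ => hI.
have inj1 (p p' : pt) : p.1 = p'.1 -> p.2 = p'.2 -> p = p'.
  by case: p => ? ?; case: p' => ? ? /= -> ->.
have [h|[h|[h|h]]] : I <= 4 * i1 \/ I <= 4 * i2 \/ I <= 4 * i3 \/ I <= 4 * i4 by lra.
- by apply: key h => p p'; apply: inj1.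
- by apply: key h => p p' a b; apply: inj1 => //; rewrite /nsnd in b; lra.
- by apply: key h => p p' a b; apply: inj1.
- by apply: key h => p p' a b; apply: inj1 => //; rewrite /nfst in b; lra.
Qed.

(** * Chains *)

(** Bounding every duplicate-free list drawn from [X] avoids proving first that [X] is finite. *)
Definition card_le (T : eqType) (X : T -> Prop) (d : nat) : Prop :=
  forall s : seq T, uniq s -> (forall t, t \in s -> X t) -> (size s <= d)%N.

Definition cube_card_le (T : eqType) (X : T -> Prop) (M : R) : Prop :=
  forall s : seq T, uniq s -> (forall t, t \in s -> X t) -> INR (size s) ^ 3 <= M.

Lemma cube_le (x y : R) : 0 <= x <= y -> x ^ 3 <= y ^ 3.
Proof. exact: pow_incr. Qed.

Lemma size_fibers (T V : eqType) (h : T -> V) (s : seq T) (d : nat) :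
  (forall v, v \in map h s -> (count (fun t => h t == v) s <= d)%N) ->
  (size s <= size (undup (map h s)) * d)%N.
Proof.
move=> hd; rewrite -(sum1_size s) (sum_fibers h) mulnC.
have -> : (d * size (undup (map h s)) = \sum_(v <- undup (map h s)) d)%N.
  by rewrite big_const_seq count_predT iter_addn_0.
rewrite big_seq [X in (_ <= X)%N]big_seq; apply: leq_sum => v.
by rewrite mem_undup sum1_count; apply: hd.
Qed.

Lemma size_fibers_of (T V : eqType) (X : T -> Prop) (h : T -> V) (s : seq T) (d : nat) :
  uniq s -> (forall t, t \in s -> X t) ->
  (forall v, card_le (fun t => X t /\ h t = v) d) ->
  (size s <= size (undup (map h s)) * d)%N.
Proof.
move=> us sX hd; apply: size_fibers => v _; rewrite -size_filter.
apply: (hd v); first exact: filter_uniq.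
by move=> t; rewrite mem_filter => /andP[/eqP e /sX].
Qed.

Lemma card_le_fibers (T V : eqType) (X : T -> Prop) (h : T -> V) (l : seq V) (d : nat) :
  (forall t, X t -> h t \in l) -> (forall v, card_le (fun t => X t /\ h t = v) d) ->
  card_le X (size l * d).
Proof.
move=> hl hd s us sX; apply: leq_trans (size_fibers_of us sX hd) _.
rewrite leq_mul2r; apply/orP; right; apply: uniq_leq_size; first exact: undup_uniq.
by move=> v; rewrite mem_undup => /mapP[t /sX /hl ? ->].
Qed.

Lemma card_le_inj (T V : eqType) (X : T -> Prop) (Y : V -> Prop) (h : T -> V) (d : nat) :
  (forall t, X t -> Y (h t)) -> (forall t t', X t -> X t' -> h t = h t' -> t = t') ->
  card_le Y d -> card_le X d.
Proof.
move=> hY inj cY s us sX; rewrite -(size_map h); apply: cY.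
  by rewrite map_inj_in_uniq // => t t' /sX ? /sX ?; apply: inj.
by move=> v /mapP[t /sX /hY ? ->].
Qed.

Lemma card_le_mem (T : eqType) (l : seq T) : card_le (fun t => t \in l) (size l).
Proof. by move=> s us sl; apply: uniq_leq_size. Qed.

Lemma cube_card_le_card (T : eqType) (X : T -> Prop) (d : nat) (M : R) :
  card_le X d -> INR d ^ 3 <= M -> cube_card_le X M.
Proof.
move=> hX hM s us sX; apply: Rle_trans hM; apply: cube_le.
by split; [apply: pos_INR | apply: INR_leq; apply: hX].
Qed.

Lemma cube_card_le_sub (T : eqType) (X Y : T -> Prop) (M : R) :
  (forall t, X t -> Y t) -> cube_card_le Y M -> cube_card_le X M.
Proof. by move=> XY hY s us sX; apply: hY => // t /sX /XY. Qed.

Lemma cube_card_le_weaken (T : eqType) (X : T -> Prop) (M M' : R) :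
  M <= M' -> cube_card_le X M -> cube_card_le X M'.
Proof. by move=> le hX s us sX; apply: Rle_trans (hX s us sX) le. Qed.

Lemma cube_card_le_fibers (T V : eqType) (X : T -> Prop) (Y : V -> Prop) (h : T -> V)
    (d : nat) (M : R) :
  (forall t, X t -> Y (h t)) -> (forall v, card_le (fun t => X t /\ h t = v) d) ->
  cube_card_le Y M -> cube_card_le X (INR d ^ 3 * M).
Proof.
move=> hY hd cY s us sX; have h1 := size_fibers_of us sX hd.
have h2 : INR (size (undup (map h s))) ^ 3 <= M.
  apply: cY; first exact: undup_uniq.
  by move=> v; rewrite mem_undup => /mapP[t /sX /hY ? ->].
apply: (@Rle_trans _ (INR (size (undup (map h s)) * d) ^ 3)).
  by apply: cube_le; split; [apply: pos_INR | apply: INR_leq].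
rewrite INR_muln Rpow_mult_distr Rmult_comm; apply: Rmult_le_compat_l => //.
by apply: pow_le; apply: pos_INR.
Qed.

(** Pigeonhole: the most populous class holds at least a fraction [1 / J] of the list. *)
Lemma cube_card_le_classes (T : eqType) (X : T -> Prop) (h : T -> nat) (J : nat) (M : R) :
  (forall t, X t -> (h t < J)%N) ->
  (forall j, (j < J)%N -> cube_card_le (fun t => X t /\ h t = j) M) ->
  cube_card_le X (INR J ^ 3 * M).
Proof.
move=> hJ hM s us sX.
(* The empty list has no most populous class; for [J > 0] a class bound applied to it gives
   [0 <= M]. *)
case: s us sX => [|t0 s'] us sX.
  have -> : INR (size (@nil T)) ^ 3 = 0 by rewrite /=; ring.
  case: J hJ hM => [|J] _ hM; first by rewrite /=; lra.
  apply: Rmult_le_pos; first by apply: pow_le; apply: pos_INR.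
  by apply: Rle_trans (hM 0%N (ltn0Sn _) [::] isT _) => //=; lra.
set s := t0 :: s' in us sX *.
have [|j [js _ mj]] := @ex_argmin _ (fun j => - INR (count (fun t => h t == j) s)) (fun=> True) (map h s).
  by exists (h t0); rewrite ?inE ?eqxx.
have hs := @size_fibers _ _ h s (count (fun t => h t == j) s).
have {hs} hs : (size s <= J * count (fun t => h t == j) s)%N.
  apply: leq_trans (hs _) _.
    by move=> v /mj /(_ I) h1; apply: leq_INR; lra.
  rewrite leq_mul2r; apply/orP; right.
  rewrite -[J in (_ <= J)%N](size_iota 0); apply: uniq_leq_size; first exact: undup_uniq.
  by move=> v; rewrite mem_undup mem_iota => /mapP[t /sX /hJ ? ->].
have jJ : (j < J)%N by case/mapP: js => t /sX /hJ ? ->.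
have hj : INR (count (fun t => h t == j) s) ^ 3 <= M.
  rewrite -size_filter; apply: (hM j jJ); first exact: filter_uniq.
  by move=> t; rewrite mem_filter => /andP[/eqP e /sX].
apply: (@Rle_trans _ (INR (J * count (fun t => h t == j) s) ^ 3)).
  by apply: cube_le; split; [apply: pos_INR | apply: INR_leq].
rewrite INR_muln Rpow_mult_distr; apply: Rmult_le_compat_l => //.
by apply: pow_le; apply: pos_INR.
Qed.

(** * Chains and the forgetting of points *)

Lemma edist_sym (p q : pt) : edist p q = edist q p.
Proof. by rewrite /edist; congr sqrt; rewrite /Rsqr; ring. Qed.

Lemma circles_meet_le2 (a b : pt) (r r' : R) : a <> b ->
  card_le (fun z => edist a z = r /\ edist z b = r') 2.
Proof.
move=> ne [|z1 [|z2 [|z3 l]]] //= us hz; exfalso.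
have zeq (z : pt) : edist a z = r /\ edist z b = r' ->
    (z.1 - a.1) ^ 2 + (z.2 - a.2) ^ 2 = r ^ 2 /\ (z.1 - b.1) ^ 2 + (z.2 - b.2) ^ 2 = r' ^ 2.
  by move=> [<- <-]; rewrite (edist_sym a) !pow2_edist.
have [e1 f1] := zeq _ (hz z1 ltac:(by rewrite !inE eqxx)).
have [e2 f2] := zeq _ (hz z2 ltac:(by rewrite !inE eqxx ?orbT)).
have [e3 f3] := zeq _ (hz z3 ltac:(by rewrite !inE eqxx ?orbT)).
have [n12 n13 n23] : [/\ z1 <> z2, z1 <> z3 & z2 <> z3].
  move: us; rewrite !inE !negb_or => /andP[/and3P[/eqP ? /eqP ? _]] /andP[/andP[/eqP ? _] _].
  by [].
pose v1 := b.1 - a.1; pose v2 := b.2 - a.2.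
have v0 : 0 < v1 ^ 2 + v2 ^ 2.
  have := pow2_ge_0 v1; have := pow2_ge_0 v2 => h1 h2.
  apply: Rnot_le_lt => le; apply: ne.
  have q1 : v1 = 0 by apply: Rsqr_0_uniq; rewrite /Rsqr; nra.
  have q2 : v2 = 0 by apply: Rsqr_0_uniq; rewrite /Rsqr; nra.
  by rewrite (surjective_pairing a) (surjective_pairing b); congr pair; [rewrite /v1 in q1 | rewrite /v2 in q2]; lra.
(* Coordinates along and across the line of centres: the former is determined, the latter up to sign. *)
pose u (z : pt) := v1 * (z.1 - a.1) + v2 * (z.2 - a.2).
pose w (z : pt) := v2 * (z.1 - a.1) - v1 * (z.2 - a.2).
have recover (z z' : pt) : u z = u z' -> w z = w z' -> z = z'.
  move=> eu ew.
  have q1 : (v1 ^ 2 + v2 ^ 2) * (z.1 - z'.1) = 0.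
    have -> : (v1 ^ 2 + v2 ^ 2) * (z.1 - z'.1) = v1 * (u z - u z') + v2 * (w z - w z') by rewrite /u /w; ring.
    by rewrite eu ew; ring.
  have q2 : (v1 ^ 2 + v2 ^ 2) * (z.2 - z'.2) = 0.
    have -> : (v1 ^ 2 + v2 ^ 2) * (z.2 - z'.2) = v2 * (u z - u z') - v1 * (w z - w z') by rewrite /u /w; ring.
    by rewrite eu ew; ring.
  have [|p1] := Rmult_integral _ _ q1; first lra.
  have [|p2] := Rmult_integral _ _ q2; first lra.
  by rewrite (surjective_pairing z) (surjective_pairing z'); congr pair; lra.
have same (z z' : pt) :
    (z.1 - a.1) ^ 2 + (z.2 - a.2) ^ 2 = r ^ 2 -> (z.1 - b.1) ^ 2 + (z.2 - b.2) ^ 2 = r' ^ 2 ->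
    (z'.1 - a.1) ^ 2 + (z'.2 - a.2) ^ 2 = r ^ 2 -> (z'.1 - b.1) ^ 2 + (z'.2 - b.2) ^ 2 = r' ^ 2 ->
    u z = u z' /\ (w z - w z') * (w z + w z') = 0.
  move=> h1 h2 h3 h4.
  have uu : u z = u z'.
    have -> : u z = (r ^ 2 - r' ^ 2 + v1 ^ 2 + v2 ^ 2) / 2 by rewrite -h1 -h2 /u /v1 /v2; field.
    by rewrite -h3 -h4 /u /v1 /v2; field.
  split=> //.
  have nrm (y : pt) : w y ^ 2 = (v1 ^ 2 + v2 ^ 2) * ((y.1 - a.1) ^ 2 + (y.2 - a.2) ^ 2) - u y ^ 2.
    by rewrite /u /w; ring.
  have -> : (w z - w z') * (w z + w z') = w z ^ 2 - w z' ^ 2 by ring.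
  by rewrite !nrm h1 h3 uu; ring.
have [u12 w12] := same _ _ e1 f1 e2 f2.
have [u13 w13] := same _ _ e1 f1 e3 f3.
have opp (z : pt) : z1 <> z -> u z1 = u z -> (w z1 - w z) * (w z1 + w z) = 0 -> w z = - w z1.
  move=> nz uz /Rmult_integral [h|h]; last lra.
  by case: nz; apply: recover => //; lra.
apply: n23; apply: recover; first by rewrite -u12 -u13.
by rewrite (opp _ n12) // (opp _ n13).
Qed.

Definition chain (k : nat) (delta : nat -> R) (P : nat -> seq pt) (t : seq pt) : Prop :=
  [/\ size t = k.+1, uniq t, forall i, (i <= k)%N -> nth p00 t i \in P i &
      forall i, (i < k)%N -> edist (nth p00 t i) (nth p00 t i.+1) = delta i].

Lemma chain_behead (k : nat) (delta : nat -> R) (P : nat -> seq pt) (p : pt) (t : seq pt) :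
  chain k.+1 delta P (p :: t) -> chain k (fun i => delta i.+1) (fun i => P i.+1) t.
Proof.
move=> [[sz] /= /andP[_ ut] mem dist]; split=> // i hi; first exact: (mem i.+1).
exact: (dist i.+1).
Qed.

Lemma chain_take (k : nat) (delta : nat -> R) (P : nat -> seq pt) (t : seq pt) :
  chain k.+1 delta P t -> chain k delta P (take k.+1 t).
Proof.
move=> [sz ut mem dist]; split.
- by rewrite size_takel // sz.
- exact: take_uniq.
- by move=> i hi; rewrite nth_take //; apply: mem; lia.
- by move=> i hi; rewrite !nth_take //; try lia; apply: dist; lia.
Qed.

Lemma cube_card_le_rev (k : nat) (delta delta' : nat -> R) (P P' : nat -> seq pt) (M : R) :
  (forall i, (i < k)%N -> delta' i = delta (k - i.+1)%N) ->
  (forall i, (i <= k)%N -> P' i = P (k - i)%N) ->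
  cube_card_le (chain k delta' P') M -> cube_card_le (chain k delta P) M.
Proof.
move=> hd hP hM s us sX; rewrite -(size_map rev); apply: hM.
  by rewrite map_inj_uniq //; apply: can_inj revK.
move=> t' /mapP[t /sX [sz ut mem dist] ->]; split.
- by rewrite size_rev.
- by rewrite rev_uniq.
- move=> i hi; rewrite nth_rev ?sz // hP //.
  by have -> : (k.+1 - i.+1 = k - i)%N by []; apply: mem; lia.
- move=> i hi; rewrite hd // !nth_rev ?sz; try lia.
  rewrite edist_sym -dist; last lia.
  by congr edist; congr nth; lia.
Qed.

(** Once the rest of the chain is known, the forgotten point is one of the at most [d] neighbours of
    the second. *)
Lemma drop_first (k d : nat) (delta : nat -> R) (P : nat -> seq pt) (M : R) :
  (forall q, q \in P 1%N -> (count (fun p => edist p q == delta 0%N) (P 0%N) <= d)%N) ->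
  cube_card_le (chain k (fun i => delta i.+1) (fun i => P i.+1)) M ->
  cube_card_le (chain k.+1 delta P) (INR d ^ 3 * M).
Proof.
move=> hd; apply: (cube_card_le_fibers (h := behead)).
  by case=> [|p t] h; [case: h | apply: chain_behead h].
move=> v.
case: (boolP (nth p00 v 0 \in P 1%N)) => [vP|nvP]; last first.
  move=> [|t s] // _ /(_ t); rewrite inE eqxx => /(_ isT) [[sz _ mem _] e].
  by case/negP: nvP; rewrite -e nth_behead; apply: (mem 1%N).
move=> s us sX; apply: leq_trans (hd _ vP); rewrite -size_filter.
move: s us sX; apply: (card_le_inj (h := head p00)) (@card_le_mem _ _).
  move=> t [[sz _ mem dist] e]; rewrite mem_filter -nth0 -e nth_behead dist // eqxx.
  exact: mem.
move=> [|p t] [|p' t'] [[//= _ _ _ _] /= e] [[//= _ _ _ _] /= e'].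
by rewrite e e' => ->.
Qed.

Lemma drop_last (k d : nat) (delta : nat -> R) (P : nat -> seq pt) (M : R) :
  (forall q, q \in P k -> (count (fun p => edist p q == delta k) (P k.+1) <= d)%N) ->
  cube_card_le (chain k delta P) M ->
  cube_card_le (chain k.+1 delta P) (INR d ^ 3 * M).
Proof.
move=> hd; apply: (cube_card_le_fibers (h := take k.+1)); first by move=> t; apply: chain_take.
move=> v.
case: (boolP (nth p00 v k \in P k)) => [vP|nvP]; last first.
  move=> [|t s] // _ /(_ t); rewrite inE eqxx => /(_ isT) [[sz _ mem _] e].
  by case/negP: nvP; rewrite -e nth_take //; apply: (mem k).
move=> s us sX; apply: leq_trans (hd _ vP); rewrite -size_filter.
move: s us sX; apply: (card_le_inj (h := fun t => nth p00 t k.+1)) (@card_le_mem _ _).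
  move=> t [[sz _ mem dist] e]; rewrite mem_filter -e nth_take // edist_sym dist // eqxx.
  exact: mem.
move=> t t' [[sz _ _ _] e] [[sz' _ _ _] e'] el.
have eq_t (x : seq pt) : size x = k.+2 -> x = rcons (take k.+1 x) (nth p00 x k.+1).
  by move=> sx; rewrite -take_nth ?sx // -sx take_size.
by rewrite (eq_t t) // (eq_t t') // e e' el.
Qed.

Definition close_pairs (r : R) (P Q : seq pt) : seq (pt * pt) :=
  [seq (p, q) | p <- P, q <- filter (fun q => edist p q == r) Q].

Lemma size_close_pairs (r : R) (P Q : seq pt) :
  size (close_pairs r P Q) = incidences (fun p q => edist p q == r) P Q.
Proof.
rewrite size_allpairs_dep sumnE big_map; apply: eq_bigr => p _.
by rewrite size_filter.
Qed.

Lemma mem_close_pairs (r : R) (P Q : seq pt) (p q : pt) :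
  p \in P -> q \in Q -> edist p q = r -> (p, q) \in close_pairs r P Q.
Proof.
move=> pP qQ e; apply/allpairsPdep; exists p, q; split=> //.
by rewrite mem_filter e eqxx.
Qed.

(* Given the second and the fourth point, the third one lies on two distinct circles. *)
Lemma drop_three (k : nat) (delta : nat -> R) (P : nat -> seq pt) (M : R) :
  cube_card_le (chain k (fun i => delta i.+3) (fun i => P i.+3)) M ->
  cube_card_le (chain k.+3 delta P)
    (INR (incidences (fun p q => edist p q == delta 0%N) (P 0%N) (P 1%N) * 2) ^ 3 * M).
Proof.
rewrite -size_close_pairs.
apply: (cube_card_le_fibers (h := drop 3)).
  case=> [|p [|q [|z t]]] h; try by case: h.
  by rewrite /= drop0; apply: chain_behead (chain_behead (chain_behead h)).
move=> v; apply: (card_le_fibers (h := fun t => (nth p00 t 0, nth p00 t 1))).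
  by move=> t [[sz _ mem dist] _]; apply: mem_close_pairs; [exact: mem|exact: mem|exact: dist].
move=> [a b].
case: (b =P nth p00 v 0) => [eb|neb].
  move=> [|t s] // _ /(_ t); rewrite inE eqxx => /(_ isT) [[[sz ut _ _] e] [_ e1]].
  move: eb; rewrite -e -e1 nth_drop => /eqP.
  by rewrite nth_uniq ?sz.
refine (card_le_inj (h := fun t => nth p00 t 2) _ _ (circles_meet_le2 (r := delta 1%N) (r' := delta 2%N) neb)).
  move=> t [[[sz ut _ dist] e] [_ e1]]; rewrite -e -e1 nth_drop.
  by split; apply: dist.
move=> t t' [[[sz _ _ _] e] [e0 e1]] [[[sz' _ _ _] e'] [e0' e1']] e2.
have eq_t (x : seq pt) : size x = k.+4 ->
    x = [:: nth p00 x 0, nth p00 x 1, nth p00 x 2 & drop 3 x].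
  by case: x => [|? [|? [|? x]]] //= _; rewrite drop0.
by rewrite (eq_t t) // (eq_t t') // e e' e0 e0' e1 e1' e2.
Qed.

(** * Dyadic splitting by degree *)

Lemma leq_incidences (A T : Type) (r : A -> T -> bool) (P : seq A) (Q : seq T) :
  (incidences r P Q <= size P * size Q)%N.
Proof.
rewrite /incidences -sum1_size big_distrl /=; apply: leq_sum => p _.
by rewrite mul1n count_size.
Qed.

(** As [d * |Q| <= I], the main case of [circle_incidences] gives the first alternative after
    cancelling [|Q| ^ 2], and [I <= 8 * |P|] is the second. If [I <= 8 * |Q|], then [d <= 8], and
    [|Q| <= n] yields the first again. *)
Lemma rich_dichotomy (r : R) (P Q : seq pt) (n d : nat) :
  0 < r -> uniq P -> uniq Q -> (3 <= n)%N -> (size P <= n)%N -> (size Q <= n)%N -> (0 < d)%N ->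
  (forall q, q \in Q -> (d <= count (fun p => edist p q == r) P)%N) ->
  INR d ^ 3 * INR (size Q) <= 24000 ^ 3 * ln (INR n) ^ 6 * INR n * INR (size P) \/
  INR (incidences (fun p q => edist p q == r) P Q) <= 8 * INR (size P).
Proof.
move=> r0 uP uQ n3 Pn Qn d0 hd.
have L1 := ln_ge1 n3; set L := ln (INR n) in L1 *.
have L6 : 1 <= L ^ 6 by apply: pow_R1_Rle.
have nP := INR_leq Pn; have nQ := INR_leq Qn.
have a0 := pos_INR (size P); have m0 := pos_INR (size Q).
case: (posnP (size Q)) => [->|Q0].
  left; rewrite Rmult_0_r; apply: Rmult_le_pos => //; apply: Rmult_le_pos; last lra.
  by apply: Rmult_le_pos; lra.
have m1 : 1 <= INR (size Q) by apply: (INR_leq Q0).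
have a1 : 1 <= INR (size P).
  case: Q Q0 hd {uQ Qn nQ m0 m1} => // q Q _ /(_ q); rewrite inE eqxx => /(_ isT) h.
  by apply: (@INR_leq 1); apply: leq_trans d0 (leq_trans h (count_size _ _)).
have dm : INR d * INR (size Q) <= INR (incidences (fun p q => edist p q == r) P Q).
  rewrite -INR_muln; apply: INR_leq; rewrite incidences_flip /incidences.
  rewrite -sum1_size big_distrr /= big_seq [X in (_ <= X)%N]big_seq.
  by apply: leq_sum => q qQ; rewrite muln1; apply: hd.
have := circle_incidences r0 uP uQ n3 Qn; rewrite -/L.
have dp := pos_INR d.
set I := INR (incidences _ _ _) in dm *; set a := INR (size P) in nP a0 a1 *.
set m := INR (size Q) in nQ m0 m1 dm *; set N := INR n in nP nQ *; set e := INR d in dp dm *.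
move=> /= [h|[h|h]]; [left | by right | left].
- have h3 : (e * m) ^ 3 <= 24000 ^ 3 * L ^ 6 * a ^ 2 * m ^ 2.
    by apply: Rle_trans h; apply: cube_le; nra.
  have h4 : m ^ 2 * (e ^ 3 * m) <= m ^ 2 * (24000 ^ 3 * L ^ 6 * (a * a)) by nra.
  have {h4} : e ^ 3 * m <= 24000 ^ 3 * L ^ 6 * (a * a) by apply: Rmult_le_reg_l h4; nra.
  move=> h4; apply: Rle_trans h4 _.
  rewrite [X in _ <= X]Rmult_assoc.
  by apply: Rmult_le_compat_l; [lra | nra].
- have e8 : e <= 8 by apply: (@Rmult_le_reg_r m); lra.
  have e3 : e ^ 3 <= 8 ^ 3 by apply: cube_le.
  have : e ^ 3 * m <= 8 ^ 3 * N by apply: Rmult_le_compat => //; apply: pow_le.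
  have : 8 ^ 3 * N <= 24000 ^ 3 * L ^ 6 * N by apply: Rmult_le_compat_r; lra.
  have : 24000 ^ 3 * L ^ 6 * N * 1 <= 24000 ^ 3 * L ^ 6 * N * a.
    by apply: Rmult_le_compat_l => //; apply: Rmult_le_pos; lra.
  lra.
Qed.

Definition replace_at (P : nat -> seq pt) (j : nat) (Q : seq pt) : nat -> seq pt :=
  fun i => if i == j then Q else P i.

Definition admissible (n k : nat) (delta : nat -> R) (P : nat -> seq pt) : Prop :=
  (forall i, (i < k)%N -> 0 < delta i) /\
  (forall i, (i <= k)%N -> uniq (P i) /\ (size (P i) <= n)%N).

Lemma admissible_tail (n k : nat) (delta : nat -> R) (P : nat -> seq pt) :
  admissible n k.+1 delta P -> admissible n k (fun i => delta i.+1) (fun i => P i.+1).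
Proof. by move=> [hd hP]; split=> i hi; [apply: hd | apply: hP]. Qed.

Lemma admissible_init (n k : nat) (delta : nat -> R) (P : nat -> seq pt) :
  admissible n k.+1 delta P -> admissible n k delta P.
Proof. by move=> [hd hP]; split=> i hi; [apply: hd | apply: hP]; lia. Qed.

Lemma admissible_replace (n k j : nat) (delta : nat -> R) (P : nat -> seq pt) (Q : seq pt) :
  admissible n k delta P -> (j <= k)%N -> uniq Q -> {subset Q <= P j} ->
  admissible n k delta (replace_at P j Q).
Proof.
move=> [hd hP] jk uQ QP; split=> // i hi; rewrite /replace_at.
case: eqP => [_|_]; last exact: hP.
by split=> //; apply: leq_trans (uniq_leq_size uQ QP) _; case: (hP j jk).
Qed.

Lemma admissible_rev (n k : nat) (delta : nat -> R) (P : nat -> seq pt) :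
  admissible n k delta P ->
  admissible n k (fun i => delta (k - i.+1)%N) (fun i => P (k - i)%N).
Proof. by move=> [hd hP]; split=> i hi; [apply: hd | apply: hP]; lia. Qed.

Lemma trunc_log_ln (n : nat) : (3 <= n)%N -> INR (trunc_log 2 n).+1 <= 3 * ln (INR n).
Proof.
move=> n3; have L1 := ln_ge1 n3; rewrite S_INR.
have n0 : (0 < n)%N by apply: leq_trans n3.
have [h _] := andP (trunc_log_bounds (isT : (1 < 2)%N) n0).
have : ln (INR (2 ^ trunc_log 2 n)) <= ln (INR n).
  by apply: ln_le_mono; [apply: lt_0_INR; apply/ltP; rewrite expn_gt0 | apply: INR_leq].
rewrite INR_expn ln_pow; last by rewrite /=; lra.
(* From [ln 2 > 1 / 2] the truncated logarithm is at most [2 * ln n], and [ln n >= 1] absorbs the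
   successor. *)
have := ln_lt_2; have := pos_INR (trunc_log 2 n); have -> : INR 2 = 2 by [].
nra.
Qed.

(** At most [3 * ln n] dyadic classes occur, whence [27 * ln n ^ 3] after cubing. In class [j] take
    [d = 2 ^ j]: degrees are at least [d], as [rich_dichotomy] requires, and at most [2 * d], as
    forgetting the first point requires. *)
Lemma split_first (n k : nat) (delta : nat -> R) (P : nat -> seq pt) (M : R) :
  (3 <= n)%N -> (0 < k)%N -> admissible n k delta P -> 0 <= M ->
  (forall Q d, uniq Q -> {subset Q <= P 1%N} ->
    (forall q, q \in Q -> (count (fun p => edist p q == delta 0%N) (P 0%N) <= 2 * d)%N) ->
    INR d ^ 3 * INR (size Q) <= 24000 ^ 3 * ln (INR n) ^ 6 * INR n * INR (size (P 0%N)) \/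
    INR (incidences (fun p q => edist p q == delta 0%N) (P 0%N) Q) <= 8 * INR (size (P 0%N)) ->
    cube_card_le (chain k delta (replace_at P 1 Q)) M) ->
  cube_card_le (chain k delta P) (27 * ln (INR n) ^ 3 * M).
Proof.
move=> n3 k0 adm M0 hQ; have [hd hP] := adm.
pose deg q := count (fun p => edist p q == delta 0%N) (P 0%N).
have n0 : (0 < n)%N by apply: leq_trans n3.
have degn q : (deg q <= n)%N by apply: leq_trans (count_size _ _) _; case: (hP 0%N).
pose J := (trunc_log 2 n).+1.
apply: (@cube_card_le_weaken _ _ (INR J ^ 3 * M)).
  apply: Rmult_le_compat_r => //.
  have -> : 27 * ln (INR n) ^ 3 = (3 * ln (INR n)) ^ 3 by ring.
  by apply: cube_le; split; [apply: pos_INR | apply: trunc_log_ln].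
apply: (cube_card_le_classes (h := fun t => trunc_log 2 (deg (nth p00 t 1)))).
  by move=> t _; rewrite ltnS; apply: leq_trunc_log.
move=> j _.
(* Degree 0 also has truncated logarithm 0 and is kept out of class 0; the second point of a chain
   always has a neighbour. *)
pose Q := filter (fun q => (0 < deg q) && (trunc_log 2 (deg q) == j))%N (P 1%N).
have [uP1 szP1] := hP 1%N k0; have [uP0 szP0] := hP 0%N (leq0n _).
have uQ : uniq Q by apply: filter_uniq.
have QP : {subset Q <= P 1%N} by move=> q; rewrite mem_filter => /andP[].
have bounds q : q \in Q -> (2 ^ j <= deg q < 2 ^ j.+1)%N.
  by rewrite mem_filter => /andP[/andP[dq /eqP <-] _]; apply: trunc_log_bounds.
apply: (@cube_card_le_sub _ _ (chain k delta (replace_at P 1 Q))).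
  move=> t [[sz ut mem dist] ht]; split=> // i hi; rewrite /replace_at.
  case: eqP => [->|_]; last exact: mem.
  rewrite mem_filter mem ?ht ?eqxx ?andbT //.
  rewrite /deg -has_count; apply/hasP; exists (nth p00 t 0); first exact: mem.
  by rewrite dist.
apply: (hQ Q (2 ^ j)%N) => //.
  by move=> q /bounds /andP[_]; rewrite expnS => /ltnW.
apply: rich_dichotomy => //.
- exact: hd.
- exact: leq_trans (uniq_leq_size uQ QP) szP1.
- by rewrite expn_gt0.
- by move=> q /bounds /andP[].
Qed.

Lemma split_last (n k : nat) (delta : nat -> R) (P : nat -> seq pt) (M : R) :
  (3 <= n)%N -> admissible n k.+1 delta P -> 0 <= M ->
  (forall Q d, uniq Q -> {subset Q <= P k} ->
    (forall q, q \in Q -> (count (fun p => edist p q == delta k) (P k.+1) <= 2 * d)%N) ->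
    INR d ^ 3 * INR (size Q) <= 24000 ^ 3 * ln (INR n) ^ 6 * INR n * INR (size (P k.+1)) \/
    INR (incidences (fun p q => edist p q == delta k) (P k.+1) Q) <= 8 * INR (size (P k.+1)) ->
    cube_card_le (chain k.+1 delta (replace_at P k Q)) M) ->
  cube_card_le (chain k.+1 delta P) (27 * ln (INR n) ^ 3 * M).
Proof.
move=> n3 adm M0 hQ.
apply: (@cube_card_le_rev _ _ (fun i => delta (k.+1 - i.+1)%N) _ (fun i => P (k.+1 - i)%N)) => //.
apply: split_first => //; first exact: admissible_rev.
rewrite !subSS !subn0 => Q d uQ QP hd hI.
apply: (@cube_card_le_rev _ _ delta _ (replace_at P k Q)); last exact: hQ hI.
  by move=> i hi; congr delta; lia.
move=> i hi; rewrite /replace_at.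
have -> : (k.+1 - i == 1)%N = (i == k) by lia.
by case: ifP => // _; congr P; lia.
Qed.

(** * Chain bounds by induction in steps of three *)

Definition chain_bound (k : nat) : Prop :=
  exists C c, 0 <= C /\ forall n delta P, (3 <= n)%N -> admissible n k delta P ->
    cube_card_le (chain k delta P)
      (C * ln (INR n) ^ c * (INR n ^ fk k * (INR (size (P 0%N)) * INR (size (P k))))).

Lemma chain_bound0 : chain_bound 0.
Proof.
exists 1, 0%N; split; first lra.
move=> n delta P n3 [_ hP]; have [u0 s0] := hP 0%N isT.
apply: (@cube_card_le_card _ _ (size (P 0%N))).
  apply: (card_le_inj (h := head p00)) (@card_le_mem _ _).
    by move=> t [_ _ mem _]; rewrite -nth0; apply: mem.
  move=> t t' [sz _ _ _] [sz' _ _ _].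
  by case: t sz => [|x [|? ?]] // _; case: t' sz' => [|x' [|? ?]] // _ /= ->.
have := INR_leq s0; have := pos_INR (size (P 0%N)).
by rewrite /fk /=; set a := INR _; set N := INR n; nra.
Qed.

Lemma chain_bound1 : chain_bound 1.
Proof.
exists (24000 ^ 3), 6%N; split; first lra.
move=> n delta P n3 [hd hP]; have [u0 s0] := hP 0%N isT; have [u1 s1] := hP 1%N isT.
pose I := incidences (fun p q => edist p q == delta 0%N) (P 0%N) (P 1%N).
apply: (@cube_card_le_card _ _ I).
  rewrite /I -size_close_pairs.
  apply: (card_le_inj (h := fun t => (nth p00 t 0, nth p00 t 1))) (@card_le_mem _ _).
    by move=> t [_ _ mem dist]; apply: mem_close_pairs; [exact: mem | exact: mem | exact: dist].
  move=> t t' [sz _ _ _] [sz' _ _ _].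
  by case: t sz => [|x [|y [|? ?]]] // _; case: t' sz' => [|x' [|y' [|? ?]]] // _ /= [-> ->].
have := circle_incidences (hd 0%N isT) u0 u1 n3 s1; rewrite -/I.
have := INR_leq (leq_incidences (fun p q => edist p q == delta 0%N) (P 0%N) (P 1%N)).
rewrite -/I INR_muln; have := INR_leq s0; have := INR_leq s1; have I0 := pos_INR I.
have := pos_INR (size (P 0%N)); have := pos_INR (size (P 1%N)).
have L1 := ln_ge1 n3; set L := ln (INR n) in L1 *.
have L6 : 1 <= L ^ 6 by apply: pow_R1_Rle.
have -> : fk 1 = 2%N by [].
set i := INR I in I0 *; set a := INR (size (P 0%N)); set b := INR (size (P 1%N)); set N := INR n.
move=> b0 a0 bN aN iab.
have ab0 : 0 <= a * b by nra.
have small : i ^ 3 <= 64 * (N ^ 2 * (a * b)) -> i ^ 3 <= 24000 ^ 3 * L ^ 6 * (N ^ 2 * (a * b)).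
  move=> h; apply: Rle_trans h _; apply: Rmult_le_compat_r; last lra.
  by apply: Rmult_le_pos => //; nra.
(* In the linear cases [i <= 8 * x] is used twice and the trivial [i <= a * b] once, which keeps
   both end sizes in the bound. *)
have sq x : 0 <= x <= N -> i <= 8 * x -> i ^ 3 <= 64 * (N ^ 2 * (a * b)).
  move=> hx ix.
  have e1 : i ^ 2 <= (8 * x) ^ 2 by apply: pow_incr.
  have e2 : x ^ 2 <= N ^ 2 by apply: pow_incr.
  have -> : i ^ 3 = i ^ 2 * i by ring.
  have -> : 64 * (N ^ 2 * (a * b)) = 64 * N ^ 2 * (a * b) by ring.
  by apply: Rmult_le_compat => //; [nra | nra].
move=> /= [h|[h|h]]; last 2 first.
- by apply: small; apply: (sq a).
- by apply: small; apply: (sq b).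
apply: Rle_trans h _.
have -> : 24000 * (24000 * (24000 * 1)) * (L * (L * (L * (L * (L * (L * 1)))))) * (a * (a * 1)) * (b * (b * 1)) =
          24000 ^ 3 * L ^ 6 * ((a * b) * (a * b)) by ring.
apply: Rmult_le_compat_l; first lra.
by apply: Rmult_le_compat_r => //; nra.
Qed.

(** The two ends are distinct, so they determine the middle point up to two choices. *)
Lemma chain_bound2 : chain_bound 2.
Proof.
exists 8, 0%N; split; first lra.
move=> n delta P n3 [hd hP]; have [u0 s0] := hP 0%N isT; have [u2 s2] := hP 2%N isT.
apply: (@cube_card_le_card _ _ (size [seq (p, q) | p <- P 0%N, q <- P 2%N] * 2)).
  apply: (card_le_fibers (h := fun t => (nth p00 t 0, nth p00 t 2))).
    by move=> t [_ _ mem _]; apply: allpairs_f; apply: mem.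
  move=> [a b]; case: (a =P b) => [eab|nab].
    move=> [|t s] // _ /(_ t); rewrite inE eqxx => /(_ isT) [[sz ut _ _] [e0 e2]].
    by move: eab; rewrite -e0 -e2 => /eqP; rewrite nth_uniq ?sz.
  refine (card_le_inj (h := fun t => nth p00 t 1) _ _ (circles_meet_le2 (r := delta 0%N) (r' := delta 1%N) nab)).
    by move=> t [[_ _ _ dist] [<- <-]]; split; apply: dist.
  move=> t t' [[sz _ _ _] [e1 e2]] [[sz' _ _ _] [e1' e2']].
  case: t sz e1 e2 => [|x [|y [|z [|? ?]]]] // _ /= -> ->.
  by case: t' sz' e1' e2' => [|x' [|y' [|z' [|? ?]]]] // _ /= -> -> ->.
rewrite size_allpairs !INR_muln; have -> : fk 2 = 4%N by [].
have := INR_leq s0; have := INR_leq s2.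
have := pos_INR (size (P 0%N)); have := pos_INR (size (P 2%N)).
set a := INR (size (P 0%N)); set b := INR (size (P 2%N)); set N := INR n.
move=> b0 a0 bN aN; have -> : INR 2 = 2 by [].
have -> : (a * b * 2) ^ 3 = 8 * 1 * ((a * a) * (b * b) * (a * b)) by ring.
have -> : 8 * ln N ^ 0 * (N ^ 4 * (a * b)) = 8 * 1 * ((N * N) * (N * N) * (a * b)) by ring.
apply: Rmult_le_compat_l; first lra.
apply: Rmult_le_compat_r; first nra.
by apply: Rmult_le_compat; nra.
Qed.

Lemma fkD3 (k : nat) : fk k.+3 = (fk k + 3)%N.
Proof.
rewrite /fk -[k.+3]addn3 modnDr; case: ifP => _; lia.
Qed.

(** At most [8 * |P 0|] choices for the first two points and two for the third give 16, whose cube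
    is 4096. Bounding [|P 0| ^ 2 * |P 3|] by [n ^ 3] matches [fkD3]. *)
Lemma chain_bound_few_pairs (k n c : nat) (C : R) (delta : nat -> R) (P : nat -> seq pt) :
  (3 <= n)%N -> admissible n k.+3 delta P -> 0 <= C ->
  (forall delta P, admissible n k delta P -> cube_card_le (chain k delta P)
     (C * ln (INR n) ^ c * (INR n ^ fk k * (INR (size (P 0%N)) * INR (size (P k)))))) ->
  INR (incidences (fun p q => edist p q == delta 0%N) (P 0%N) (P 1%N)) <= 8 * INR (size (P 0%N)) ->
  cube_card_le (chain k.+3 delta P)
    (4096 * C * ln (INR n) ^ c * (INR n ^ fk k.+3 * (INR (size (P 0%N)) * INR (size (P k.+3))))).
Proof.
move=> n3 adm C0 IH hI; have L1 := ln_ge1 n3.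
have adm3 := admissible_tail (admissible_tail (admissible_tail adm)).
apply: cube_card_le_weaken (drop_three (IH _ _ adm3)).
have [_ hP] := adm; have [_ /INR_leq s0] := hP 0%N isT; have [_ /INR_leq s3] := hP 3%N isT.
rewrite INR_muln fkD3 pow_add; have -> : INR 2 = 2 by [].
have i0 := pos_INR (incidences (fun p q => edist p q == delta 0%N) (P 0%N) (P 1%N)).
have a0 := pos_INR (size (P 0%N)); have m0 := pos_INR (size (P 3%N)); have b0 := pos_INR (size (P k.+3)).
set i := INR (incidences _ _ _) in i0 hI *; set a := INR (size (P 0%N)) in s0 a0 hI *.
set m := INR (size (P 3%N)) in s3 m0 *; set b := INR (size (P k.+3)) in b0 *.
set N := INR n in s0 s3 *; set L := ln N in L1 *.
have N0 : 0 <= N by lra.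
have F0 : 0 <= N ^ fk k by apply: pow_le.
have H0 : 0 <= C * L ^ c by apply: Rmult_le_pos => //; apply: pow_le; lra.
have e1 : (i * 2) ^ 3 <= (16 * a) ^ 3 by apply: cube_le; lra.
apply: (@Rle_trans _ ((16 * a) ^ 3 * (C * L ^ c * (N ^ fk k * (m * b))))).
  by apply: Rmult_le_compat_r => //; do !apply: Rmult_le_pos => //; apply: pow_le; lra.
have -> : (16 * a) ^ 3 * (C * L ^ c * (N ^ fk k * (m * b))) =
          4096 * (C * L ^ c * N ^ fk k * (a * b)) * (a * a * m) by ring.
have -> : 4096 * C * L ^ c * (N ^ fk k * N ^ 3 * (a * b)) =
          4096 * (C * L ^ c * N ^ fk k * (a * b)) * (N * N * N) by ring.
apply: Rmult_le_compat_l.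
  by apply: Rmult_le_pos; [lra|]; do !apply: Rmult_le_pos => //; apply: pow_le; lra.
by apply: Rmult_le_compat => //; nra.
Qed.

Lemma le_log_factor (L C C' Z : R) (c c' : nat) :
  1 <= L -> 0 <= C <= C' -> (c <= c')%N -> 0 <= Z -> C * L ^ c * Z <= C' * L ^ c' * Z.
Proof.
move=> L1 hC cc Z0; apply: Rmult_le_compat_r => //.
apply: Rmult_le_compat; [lra | by apply: pow_le; lra | lra |].
by apply: Rle_pow => //; apply/leP.
Qed.

(** Forgetting an end point costs one factor [n] in the cubed bound. One end suffices when
    [fk k.+2 + 1 <= fk k.+3]; if 3 divides [k + 3] this fails by one, but [fk k.+1 + 2 = fk k.+3]
    allows forgetting both ends. *)
Lemma chain_bound_step (k : nat) :
  chain_bound k -> chain_bound k.+1 -> chain_bound k.+2 -> chain_bound k.+3.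
Proof.
move=> [C0 [c0 [C0p IH0]]] [C1 [c1 [C1p IH1]]] [C2 [c2 [C2p IH2]]].
pose K := 24000 ^ 3.
have K0 : 0 <= K by rewrite /K; lra.
case: (boolP (k.+3 %% 3 == 0)%N) => hk.
- have ef : fk k.+3 = (fk k.+1 + 2)%N.
    by rewrite /fk; do 2 case: ifP; lia.
  (* [D] and [e] cover both outcomes: 4096 from [chain_bound_few_pairs], and [64 = 2 ^ 3 * 2 ^ 3],
     [K ^ 2] and [12 = 6 + 6] from forgetting both ends. Each of the two splittings adds a factor
     [27 * L ^ 3]. *)
  pose D := 4096 * C0 + 64 * K ^ 2 * C1.
  have KC1 : 0 <= 64 * K ^ 2 * C1 by apply: Rmult_le_pos => //; nra.
  pose e := (c0 + c1 + 12)%N.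
  exists (27 * (27 * D)), (6 + e)%N; split; first by rewrite /D; lra.
  move=> n delta P n3 adm; have L1 := ln_ge1 n3.
  set Z := INR n ^ _ * _.
  have Z0 : 0 <= Z.
    rewrite /Z; apply: Rmult_le_pos; first by apply: pow_le; apply: pos_INR.
    by apply: Rmult_le_pos; apply: pos_INR.
  set L := ln (INR n) in L1 *.
  pose M := D * L ^ e * Z.
  have M0 : 0 <= M.
    by rewrite /M; apply: Rmult_le_pos => //; apply: Rmult_le_pos; [rewrite /D; lra | apply: pow_le; lra].
  have L3 : 0 <= L ^ 3 by apply: pow_le; lra.
  have -> : 27 * (27 * D) * L ^ (6 + e) * Z = 27 * L ^ 3 * (27 * L ^ 3 * M).
    by rewrite pow_add /M; ring.
  apply: split_first => //; first by apply: Rmult_le_pos => //; lra.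
  move=> Q d uQ QP hd hI.
  have adm1 := admissible_replace adm (isT : (1 <= k.+3)%N) uQ QP.
  set P1 := replace_at P 1 Q in adm1 *.
  case: hI => [good|bad]; last first.
    apply: cube_card_le_weaken (chain_bound_few_pairs n3 adm1 C0p (fun delta P => IH0 n delta P n3) bad).
    rewrite -/L -/Z; apply: (@Rle_trans _ M).
      by apply: le_log_factor => //; [rewrite /D; lra | rewrite /e; lia].
    (* Here the last end is not split, so the factor [27 * L ^ 3] is to spare. *)
    have : 1 <= L ^ 3 by apply: pow_R1_Rle.
    nra.
  apply: split_last => //.
  move=> Q' d' uQ' QP' hd' hI'.
  have adm2 := admissible_replace adm1 (leqnSn _ : (k.+2 <= k.+3)%N) uQ' QP'.
  set P2 := replace_at P1 k.+2 Q' in adm2 *.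
  have e2 : P2 k.+2 = Q' by rewrite /P2 /replace_at eqxx.
  have e3 : P2 k.+3 = P k.+3 by rewrite /P2 /P1 /replace_at !eqn_leq ltnn.
  case: hI' => [good'|bad'].
    have hb : cube_card_le (chain k.+3 delta P2) (INR (2 * d) ^ 3 * (INR (2 * d') ^ 3 *
        (C1 * L ^ c1 * (INR n ^ fk k.+1 * (INR (size Q) * INR (size Q')))))).
      apply: drop_first => //; apply: drop_last; first by move=> q; rewrite e2 e3; apply: hd'.
      rewrite -e2.
      exact: (IH1 n _ _ n3 (admissible_init (admissible_tail adm2))).
    apply: cube_card_le_weaken hb.
    apply: (@Rle_trans _ (64 * K ^ 2 * C1 * L ^ (c1 + 12) * Z)); last first.
      by apply: le_log_factor => //; [rewrite /D; lra | rewrite /e; lia].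
    rewrite !INR_muln; have -> : INR 2 = 2 by [].
    rewrite /Z ef !pow_add.
    move: good good'; rewrite -/K -/L (erefl : P1 k.+3 = P k.+3).
    have := pos_INR (size (P 0%N)); have := pos_INR (size (P k.+3)).
    have := pos_INR (size Q); have := pos_INR (size Q'); have := pos_INR d; have := pos_INR d'.
    set a := INR (size (P 0%N)); set b := INR (size (P k.+3)).
    set m := INR (size Q); set m' := INR (size Q').
    set x := INR d; set x' := INR d'; set N := INR n.
    move=> x'0 x0 m'0 m0 b0 a0 g g'.
    have F0 : 0 <= N ^ fk k.+1 by apply: pow_le; apply: pos_INR.
    have Lc0 : 0 <= L ^ c1 by apply: pow_le; lra.
    (* The regrouping pairs each cubed degree with the size of its class, as in the first
       alternative of [rich_dichotomy]. *)
    have -> : (2 * x) ^ 3 * ((2 * x') ^ 3 * (C1 * L ^ c1 * (N ^ fk k.+1 * (m * m')))) =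
        64 * (C1 * L ^ c1 * N ^ fk k.+1) * ((x ^ 3 * m) * (x' ^ 3 * m')) by ring.
    have -> : 64 * K ^ 2 * C1 * (L ^ c1 * L ^ 12) * (N ^ fk k.+1 * N ^ 2 * (a * b)) =
        64 * (C1 * L ^ c1 * N ^ fk k.+1) * ((K * L ^ 6 * N * a) * (K * L ^ 6 * N * b)) by ring.
    apply: Rmult_le_compat_l; first by apply: Rmult_le_pos; [lra | do !apply: Rmult_le_pos].
    by apply: Rmult_le_compat => //; apply: Rmult_le_pos => //; apply: pow_le.
  (* Few pairs at the last end: the chain is reversed so that they come first. *)
  apply: (@cube_card_le_rev _ _ (fun i => delta (k.+3 - i.+1)%N) _ (fun i => P2 (k.+3 - i)%N)) => //.
  have admr := admissible_rev adm2.
  have hr := chain_bound_few_pairs n3 admr C0p (fun delta P => IH0 n delta P n3).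
  apply: cube_card_le_weaken (hr _).
    rewrite subnn subn0 -/L.
    have -> : 4096 * C0 * L ^ c0 * (INR n ^ fk k.+3 * (INR (size (P2 k.+3)) * INR (size (P2 0%N)))) = 4096 * C0 * L ^ c0 * Z.
      by rewrite e3 (erefl : P2 0%N = P 0%N) /Z; ring.
    by apply: le_log_factor => //; [rewrite /D; lra | rewrite /e; lia].
  by rewrite !subSS !subn0 e2 e3.
- have ef : (fk k.+2 + 1 <= fk k.+3)%N.
    by rewrite /fk; do 2 case: ifP; lia.
  pose D := 4096 * C0 + 8 * K * C2.
  have KC2 : 0 <= 8 * K * C2 by apply: Rmult_le_pos => //; lra.
  pose e := (c0 + c2 + 6)%N.
  exists (27 * D), (3 + e)%N; split; first by rewrite /D; lra.
  move=> n delta P n3 adm; have L1 := ln_ge1 n3.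
  set Z := INR n ^ _ * _.
  have Z0 : 0 <= Z.
    rewrite /Z; apply: Rmult_le_pos; first by apply: pow_le; apply: pos_INR.
    by apply: Rmult_le_pos; apply: pos_INR.
  set L := ln (INR n) in L1 *.
  pose M := D * L ^ e * Z.
  have M0 : 0 <= M.
    by rewrite /M; apply: Rmult_le_pos => //; apply: Rmult_le_pos; [rewrite /D; lra | apply: pow_le; lra].
  have -> : 27 * D * L ^ (3 + e) * Z = 27 * L ^ 3 * M.
    by rewrite pow_add /M; ring.
  apply: split_first => //.
  move=> Q d uQ QP hd hI.
  have adm1 := admissible_replace adm (isT : (1 <= k.+3)%N) uQ QP.
  set P1 := replace_at P 1 Q in adm1 *.
  case: hI => [good|bad]; last first.
    apply: cube_card_le_weaken (chain_bound_few_pairs n3 adm1 C0p (fun delta P => IH0 n delta P n3) bad).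
    rewrite -/L -/Z.
    by apply: le_log_factor => //; [rewrite /D; lra | rewrite /e; lia].
  have hb : cube_card_le (chain k.+3 delta P1) (INR (2 * d) ^ 3 *
      (C2 * L ^ c2 * (INR n ^ fk k.+2 * (INR (size Q) * INR (size (P k.+3)))))).
    by apply: drop_first => //; exact: (IH2 n _ _ n3 (admissible_tail adm1)).
  apply: cube_card_le_weaken hb.
  apply: (@Rle_trans _ (8 * K * C2 * L ^ (c2 + 6) * Z)); last first.
    by apply: le_log_factor => //; [rewrite /D; lra | rewrite /e; lia].
  rewrite INR_muln; have -> : INR 2 = 2 by [].
  have N1 : 1 <= INR n by apply: (@INR_leq 1); apply: leq_trans n3.
  have hZ : INR n ^ (fk k.+2 + 1) <= INR n ^ fk k.+3 by apply: Rle_pow => //; apply/leP.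
  rewrite pow_add in hZ.
  move: good; rewrite -/K -/L /Z pow_add; move: N1 hZ.
  have := pos_INR (size (P 0%N)); have := pos_INR (size (P k.+3)).
  have := pos_INR (size Q); have := pos_INR d.
  set a := INR (size (P 0%N)); set b := INR (size (P k.+3)); set m := INR (size Q).
  set x := INR d; set N := INR n.
  move=> x0 m0 b0 a0 N1 hZ g.
  have F0 : 0 <= N ^ fk k.+2 by apply: pow_le; lra.
  have Lc0 : 0 <= L ^ c2 by apply: pow_le; lra.
  have L60 : 0 <= L ^ 6 by apply: pow_le; lra.
  have -> : (2 * x) ^ 3 * (C2 * L ^ c2 * (N ^ fk k.+2 * (m * b))) =
     8 * (C2 * L ^ c2 * N ^ fk k.+2 * b) * (x ^ 3 * m) by ring.
  apply: (@Rle_trans _ (8 * (C2 * L ^ c2 * N ^ fk k.+2 * b) * (K * L ^ 6 * N * a))).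
    apply: Rmult_le_compat_l => //.
    by apply: Rmult_le_pos; [lra | do !apply: Rmult_le_pos].
  have -> : 8 * (C2 * L ^ c2 * N ^ fk k.+2 * b) * (K * L ^ 6 * N * a) =
     8 * K * C2 * (L ^ c2 * L ^ 6) * (N ^ fk k.+2 * N ^ 1 * (a * b)) by ring.
  apply: Rmult_le_compat_l; first by do !apply: Rmult_le_pos => //; lra.
  by apply: Rmult_le_compat_r => //; apply: Rmult_le_pos.
Qed.

Lemma chain_bound_all (k : nat) : chain_bound k.
Proof.
suff [] : [/\ chain_bound k, chain_bound k.+1 & chain_bound k.+2] by [].
elim: k => [|k [h0 h1 h2]]; last by split=> //; apply: chain_bound_step.
by split; [exact: chain_bound0 | exact: chain_bound1 | exact: chain_bound2].
Qed.

(** * From tuples to the final exponents *)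

Lemma mem_tuples (ls : seq (seq pt)) (t : seq pt) : t \in tuples ls ->
  size t = size ls /\ forall i, (i < size ls)%N -> nth p00 t i \in nth [::] ls i.
Proof.
elim: ls t => [|l ls IH] t /=; first by rewrite inE => /eqP ->.
move/flattenP => [u /mapP[p pl ->] /mapP[t' /IH [sz mem] ->]] /=.
by split=> [|[|i] hi //=]; [rewrite sz | apply: mem].
Qed.

Lemma tuples_uniq (ls : seq (seq pt)) : all uniq ls -> uniq (tuples ls).
Proof.
elim: ls => [|l ls IH] //= /andP[ul /IH ut].
apply: (@allpairs_uniq _ _ _ (fun p t => p :: t) l (tuples ls)) => //.
by move=> [p t] [p' t'] _ _ /= [-> ->].
Qed.

Lemma Ck_cube_le (k : nat) (delta : nat -> R) (P : nat -> seq pt) (M : R) :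
  (forall i, (i <= k)%N -> uniq (P i)) -> cube_card_le (chain k delta P) M ->
  INR (Ck k delta P) ^ 3 <= M.
Proof.
move=> uP hM; rewrite /Ck -size_filter; apply: hM.
  apply: filter_uniq; apply: tuples_uniq; apply/allP => l /mapP[i].
  by rewrite mem_iota add0n ltnS => /= hi ->; apply: uP.
move=> t; rewrite mem_filter => /andP[/andP[ut /allP dist] /mem_tuples].
rewrite size_map size_iota => -[sz mem]; split=> // i hi.
  by have := mem i; rewrite ltnS hi (nth_map 0%N) ?size_iota ?nth_iota ?add0n //; apply.
by apply/eqP; apply: dist; rewrite mem_iota add0n.
Qed.

Unset Implicit Arguments.

Theorem theorem3p3 :
  forall (k : nat) (delta : nat -> R) (x y : R),
    (forall i : nat, (i < k)%N -> 0 < delta i) ->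
    0 <= x <= 1 -> 0 <= y <= 1 ->
    (k = 0%N -> x = y) ->
    exists c C : R, 0 < c /\ 0 < C /\
      exists N : nat, forall n : nat, (N <= n)%N ->
        forall P : nat -> seq pt,
          (forall i : nat, (i <= k)%N ->
             uniq (P i) /\ INR (size (P i)) <= size_bound k x y n i) ->
          INR (Ck k delta P) <=
             C * Rpower (ln (INR n)) c
               * Rpower (INR n) ((INR (fk k) + x + y) / 3).
Proof.
move=> k delta x y hdelta hx hy hxy.
have [C [c [C0 hC]]] := chain_bound_all k.
(* Adding 1 makes both witnesses positive; [n >= 3] gives [ln n >= 1], so the larger exponent only
   weakens the bound. *)
exists (INR c + 1), (C + 1); have c0 := pos_INR c; do 2! (split; first lra).
exists 3%N => n n3 P hP; have L1 := ln_ge1 n3.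
have n1 : 1 <= INR n by apply: (@INR_leq 1); apply: leq_trans n3.
have pow_le_n z : 0 <= z <= 1 -> Rpower (INR n) z <= INR n.
  by move=> hz; rewrite -[X in _ <= X](Rpower_1 (INR n)); [apply: Rle_Rpower | ]; lra.
have adm : admissible n k delta P.
  split=> // i /hP [u sz]; split=> //; apply: leq_INR; apply: Rle_trans sz _.
  rewrite /size_bound; case: ifP => _; first exact: pow_le_n.
  by case: ifP => _; [apply: pow_le_n | lra].
have ha : INR (size (P 0%N)) <= Rpower (INR n) x by have [] := hP 0%N (leq0n _).
have hb : INR (size (P k)) <= Rpower (INR n) y.
  have [_] := hP k (leqnn _); rewrite /size_bound eqxx.
  (* For [k = 0] the single set is bounded by [n ^ x], and [x = y] turns this into [n ^ y]. *)
  by case: eqP => // /hxy ->.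
have := Ck_cube_le (fun i hi => (hP i hi).1) (hC n delta P n3 adm).
set cnt := INR (Ck k delta P); set L := ln (INR n) in L1 *; set N := INR n in n1 ha hb *.
set Z := (C + 1) * _ * _ => h.
have expR_pos a b : 0 < Rpower a b by apply: exp_pos.
have Z0 : 0 < Z by do !apply: Rmult_lt_0_compat => //; lra.
have cube a b : Rpower a b ^ 3 = Rpower a (b * 3).
  by rewrite -Rpower_pow // Rpower_mult; congr (Rpower _ (_ * _)); rewrite /=; lra.
have eZ : Z ^ 3 = (C + 1) ^ 3 * Rpower L ((INR c + 1) * 3) *
    (N ^ fk k * (Rpower N x * Rpower N y)).
  rewrite /Z !Rpow_mult_distr !cube; congr (_ * _).
  have -> : (INR (fk k) + x + y) / 3 * 3 = INR (fk k) + (x + y) by field.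
  by rewrite !Rpower_plus Rpower_pow; last lra.
have le3 : cnt ^ 3 <= Z ^ 3.
  apply: Rle_trans h _; rewrite eZ.
  have Lc0 : 0 <= L ^ c by apply: pow_le; lra.
  have Nf0 : 0 <= N ^ fk k by apply: pow_le; lra.
  have := pos_INR (size (P 0%N)); have := pos_INR (size (P k)) => b0 a0.
  apply: Rmult_le_compat.
  - exact: Rmult_le_pos.
  - by do !apply: Rmult_le_pos.
  - apply: Rmult_le_compat => //; first nra.
    by rewrite -Rpower_pow; [apply: Rle_Rpower; lra | lra].
  - by apply: Rmult_le_compat_l => //; apply: Rmult_le_compat.
(* The cube root is taken by factoring [cnt ^ 3 - Z ^ 3], whose quadratic cofactor is positive. *)
apply: Rnot_lt_le => lt.
have : 0 < (cnt - Z) * (cnt ^ 2 + cnt * Z + Z ^ 2) by apply: Rmult_lt_0_compat; nra.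
have <- : cnt ^ 3 - Z ^ 3 = (cnt - Z) * (cnt ^ 2 + cnt * Z + Z ^ 2) by ring.
lra.
Qed.
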